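(* The following weighted spherical designs exist, each obtained as a weighted union of two orbits (of lines) of a finite reflection group: (1) a $32$ point spherical $(9,9)$-design for $\mathbb{C}^2$; (2) a $48$ point spherical $(4,4)$-design for $\mathbb{C}^3$; (3) a $400$ point spherical $(5,5)$-design for $\mathbb{C}^4$; (4) a $360$ point spherical $(9,9)$-design for $\mathbb{R}^4$ (i.e. a weighted spherical half-design of order $18$), and hence a $720$ point weighted spherical $19$-design for $\mathbb{R}^4$. In (1)-(3) the group is a finite complex reflection group acting unitarily on the given space, and in (4) it is a finite real reflection group acting orthogonally on $\mathbb{R}^4$.
   Context: Let $\mathbb{F}=\mathbb{R}$ or $\mathbb{C}$, and $$c_t(\mathbb{C}^d)=\frac{1}{\binom{t+d-1}{t}},\qquad c_t(\mathbb{R}^d)=\frac{1\cdot3\cdot5\cdots(2t-1)}{d(d+2)\cdots(d+2(t-1))}.$$ A finite set of unit vectors $X\subset\mathbb{F}^d$ with weights $w_x\in\mathbb{R}$, $\sum_{x\in X} w_x=1$, is a (weighted) spherical $(t,t)$-design for $\mathbb{F}^d$ if $\sum_{x\in X}\sum_{y\in X}w_xw_y|\langle x,y\rangle|^{2t}=c_t(\mathbb{F}^d)$. Here the weights are positive. For $\mathbb{F}=\mathbb{R}$ such a design is also called a weighted spherical half-design of order $2t$. This property does not change when vectors are multiplied by unit scalars, so vectors are identified with the lines they span, and the number of points of a spherical $(t,t)$-design is the number of distinct lines. A weighted union of two orbits of a group $G$ means: one unit vector is taken from each line in the set $\{\mathbb{F}gx: g\in G\}\cup\{\mathbb{F}gy:g\in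 G\}$, for two vectors $x,y$, with the weights constant on each of the two orbits of lines. A complex (respectively real) reflection group is a group of linear maps generated by maps of finite order that fix a hyperplane pointwise. A weighted spherical $m$-design for $\mathbb{R}^d$ is a finite set of points $X$ of the unit sphere $\mathbb{S}$ with positive weights $w_x$ adding to $1$ such that $\int_{\mathbb{S}}f\,d\sigma=\sum_{x\in X}w_xf(x)$ for every polynomial $f$ of degree at most $m$, where $\sigma$ is normalised surface area measure. *)

(* Defs.v *)
From HB Require Import structures.
From mathcomp Require Import all_boot all_order all_algebra.
From mathcomp Require Import finmap.
(* the notations of mpoly clash with those of the analysis library *)
From mathcomp Require Import -(notations) mpoly.
From mathcomp Require Import all_classical all_reals all_analysis.
From mathcomp Require Export complex.

Set Implicit Arguments.
Unset Strict Implicit.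
Unset Printing Implicit Defensive.

Import Order.TTheory GRing.Theory Num.Theory.

Local Open Scope classical_set_scope.
Local Open Scope ring_scope.

(* F^d is treated uniformly as 'cV[F]_d with a conjugation [conj] on F:
   the identity for F = R, complex conjugation for F = R[i]. *)
Section Designs.
Context (F : numFieldType) (conj : F -> F) (d : nat).
Implicit Types (x y : 'cV[F]_d) (X : {fset 'cV[F]_d}) (w : 'cV[F]_d -> F).
Implicit Types (g : 'M[F]_d) (S G : set 'M[F]_d).

Definition inner x y : F := \sum_i x i 0 * conj (y i 0).

(* In a numFieldType 0 < w x entails that w x is real, also when F = R[i]. *)
Definition weighted_unit_vectors X w :=
  [/\ {in X, forall x, inner x x = 1}, {in X, forall x, 0 < w x} &
      \sum_(x <- X) w x = 1].

Definition spherical_tt_design (c : F) (t : nat) X w :=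
  weighted_unit_vectors X w /\
  \sum_(x <- X) \sum_(y <- X) w x * w y * `|inner x y| ^+ (2 * t) = c.

Definition line x : set 'cV[F]_d := [set a *: x | a in [set: F]].

(* points of a (t,t)-design are counted up to multiplication by unit scalars *)
Definition num_lines X : nat := #|` [fset line x | x in X]%fset |.

(* the hyperplane is the kernel of the nonzero linear form h *)
Definition reflection g :=
  (exists2 n, (0 < n)%N & g ^+ n = 1%:M) /\
  (exists2 h : 'rV[F]_d, h != 0 & forall x, h *m x = 0 -> g *m x = x).

Definition matrix_group G :=
  [/\ G 1%:M, forall g1 g2, G g1 -> G g2 -> G (g1 *m g2) &
      forall g, G g -> g \in unitmx /\ G (invmx g)].

Definition generated_group S : set 'M[F]_d := smallest matrix_group S.

Definition reflection_group G :=
  exists2 S, S `<=` reflection & G = generated_group S.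

Definition isometric G :=
  forall g, G g -> forall x y, inner (g *m x) (g *m y) = inner x y.

Definition finite_isometric_reflection_group G :=
  [/\ finite_set G, reflection_group G & isometric G].

Definition line_orbit G x : set (set 'cV[F]_d) := [set line (g *m x) | g in G].

Definition weighted_union_of_two_orbits G X w :=
  exists x y, [/\ x != 0 /\ y != 0,
    line_orbit G x <> line_orbit G y,
    {in X &, injective line},
    line @` [set` X] = line_orbit G x `|` line_orbit G y &
    forall z, z = x \/ z = y ->
      {in X &, forall u v, line_orbit G z (line u) -> line_orbit G z (line v) ->
        w u = w v}].

End Designs.

Definition c_complex (F : numFieldType) (d t : nat) : F :=
  ('C(t + d - 1, t))%:R^-1.

Definition c_real (F : numFieldType) (d t : nat) : F :=
  \prod_(i < t) (2 * i + 1)%:R / \prod_(i < t) (d + 2 * i)%:R.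

Section RealComplex.
Context (R : realType) (d : nat).

Definition complex_tt_design (t : nat) (X : {fset 'cV[R[i]]_d})
    (w : 'cV[R[i]]_d -> R[i]) :=
  spherical_tt_design Num.conj (c_complex R[i] d t) t X w.

(* also known as a weighted spherical half-design of order 2t *)
Definition real_tt_design (t : nat) (X : {fset 'cV[R]_d}) (w : 'cV[R]_d -> R) :=
  spherical_tt_design idfun (c_real R d t) t X w.

Definition finite_complex_reflection_group (G : set 'M[R[i]]_d) :=
  finite_isometric_reflection_group Num.conj G.

Definition finite_real_reflection_group (G : set 'M[R]_d) :=
  finite_isometric_reflection_group idfun G.

End RealComplex.

Section SurfaceMeasure.
Context (R : realType).
Local Notation Rvec d := (d.-tuple (measurableTypeR R)).

Definition cons_vec d (p : measurableTypeR R * Rvec d) : Rvec d.+1 :=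
  [tuple of p.1 :: p.2].

(* Lebesgue measure on R^d, by the identification R * R^d = R^d.+1; it is shown
   below to be a sigma-finite measure. *)
Fixpoint lebesgue_vec d : set (Rvec d) -> \bar R :=
  match d with
  | 0 => \d_[tuple]
  | d'.+1 => pushforward (@lebesgue_measure R \x @lebesgue_vec d')%E (@cons_vec d')
  end.

Let measurable_cons_vec d : measurable_fun [set: _] (@cons_vec d).
Proof. exact: measurable_cons. Qed.

Let lebesgue_vec_sigma_finite_measure d :
  {mu : {sigma_finite_measure set (Rvec d) -> \bar R} |
    @lebesgue_vec d = mu :> (set _ -> _)}.
Proof.
elim: d => [|d [mu IH]] /=; first by exists (\d_[tuple]).
pose f : measurableTypeR R * Rvec d -> Rvec d.+1 := @cons_vec d.
pose mf : measurable_fun setT f := @measurable_cons_vec d.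
pose prod : {measure set (measurableTypeR R * Rvec d)%type -> \bar R} :=
  (@lebesgue_measure R \x mu)%E.
pose nu : {measure set (Rvec d.+1) -> \bar R} :=
  measure_function_pushforward__canonical__measure_function_Measure prod mf.
have sfnu : sigma_finite setT nu.
  pose g (v : Rvec d.+1) : measurableTypeR R * Rvec d :=
    (thead v, [tuple of behead v]).
  have mg : measurable_fun setT g.
    apply: measurable_fun_pair => /=; first exact: measurable_tnth.
    exact: measurable_behead.
  have /sigma_finiteP[F [TF ndF Foo]] := sigma_finiteT (@lebesgue_measure R).
  have /sigma_finiteP[G [TG ndG Goo]] := sigma_finiteT mu.
  exists (fun n => g @^-1` (F n `*` G n)).
    rewrite -preimage_bigcup -[LHS](preimage_setT g); congr (_ @^-1` _).
    rewrite -setXTT TF TG predeqE => -[x y]; split; last first.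
      by move=> [n _ []/= ? ?]; split; exists n.
    move=> [/= [n _ Fnx] [k _ Gky]]; exists (maxn n k) => //; split.
    - by move: x Fnx; exact/subsetPset/ndF/leq_maxl.
    - by move: y Gky; exact/subsetPset/ndG/leq_maxr.
  move=> n; have [mF oF] := Foo n; have [mG oG] := Goo n; split.
    by rewrite -[X in measurable X]setTI; apply: mg => //; exact: measurableX.
  rewrite /nu/= /pushforward (_ : f @^-1` _ = F n `*` G n).
    by rewrite [prod _]product_measure1E// lte_mul_pinfty// ge0_fin_numE.
  apply/funext => -[x v]; rewrite /preimage /=.
  have gK : g (f (x, v)) = (x, v) by rewrite /g theadE; congr pair; exact/val_inj.
  exact: (congr1 (F n `*` G n) gK).
pose sf := @isSigmaFinite.Build _ _ _ nu sfnu.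
pose sF := @isSFinite.Build _ _ _ nu (sfinite_measure_sigma_finite sfnu).
pose munu : {sigma_finite_measure set (Rvec d.+1) -> \bar R} :=
  HB.pack (Measure.sort nu) sF sf.
by exists munu; rewrite IH.
Qed.

Section instances.
Variable d : nat.
Let mu := sval (lebesgue_vec_sigma_finite_measure d).
Let muE : @lebesgue_vec d = mu :> (set _ -> _) :=
  svalP (lebesgue_vec_sigma_finite_measure d).

Let lebesgue_vec0 : @lebesgue_vec d set0 = 0%E.
Proof. by rewrite muE measure0. Qed.

Let lebesgue_vec_ge0 A : (0 <= @lebesgue_vec d A)%E.
Proof. by rewrite muE. Qed.

Let lebesgue_vec_semi_sigma_additive : semi_sigma_additive (@lebesgue_vec d).
Proof. by rewrite muE; exact: measure_semi_sigma_additive. Qed.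

HB.instance Definition _ := isMeasure.Build _ _ _ (@lebesgue_vec d)
  lebesgue_vec0 lebesgue_vec_ge0 lebesgue_vec_semi_sigma_additive.

Let lebesgue_vec_sigma_finite : sigma_finite setT (@lebesgue_vec d).
Proof. by rewrite muE; exact: sigma_finiteT. Qed.

HB.instance Definition _ := Measure_isSigmaFinite.Build _ _ _ (@lebesgue_vec d)
  lebesgue_vec_sigma_finite.

End instances.

Definition enorm d (v : Rvec d) : R := Num.sqrt (\sum_i tnth v i ^+ 2).

Definition sphere d : set (Rvec d) := [set v | enorm v = 1].

Definition cone d (A : set (Rvec d)) : set (Rvec d) :=
  [set v | exists r a, [/\ 0 < r <= 1, sphere a, A a &
                           v = [tuple r * tnth a i | i < d]]].

(* Normalised surface area of A `&` sphere, as the cone measure: the volume of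
   the cone over A with apex 0, relative to the volume of the unit ball. *)
Definition sphere_measure d (A : set (Rvec d)) : \bar R :=
  ((fine (lebesgue_vec (cone [set: Rvec d])))^-1%:E * lebesgue_vec (cone A))%E.

Definition spherical_design d (m : nat) (X : {fset 'cV[R]_d}) (w : 'cV[R]_d -> R) :=
  weighted_unit_vectors idfun X w /\
  forall p : mpoly d R, (msize p <= m.+1)%N ->
    (\int[@sphere_measure d]_(v in @sphere d) (meval (tnth v) p)%:E)%E =
    (\sum_(x <- X) w x * meval (fun i => x i 0) p)%:E.

(* X `|` - X, with the weight of each x in X split evenly between x and - x *)
Definition antipodal_double d (X : {fset 'cV[R]_d}) (w : 'cV[R]_d -> R)
    (Y : {fset 'cV[R]_d}) (v : 'cV[R]_d -> R) :=
  Y = (X `|` [fset - x | x in X])%fset /\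
  {in X, forall x, v x = w x / 2 /\ v (- x) = w x / 2}.

End SurfaceMeasure.

(* Main.v *)
Require Import Defs.
From HB Require Import structures.
From Stdlib Require Import ZArith.
From mathcomp Require Import all_boot all_order all_algebra.
From mathcomp Require Import finmap complex ssrZ zify ring lra.
From mathcomp Require Import -(notations) mpoly.
From mathcomp Require Import all_classical all_reals all_analysis.
From mathcomp Require Import measurable_realfun.

Set Implicit Arguments.
Unset Strict Implicit.
Unset Printing Implicit Defensive.

Import Order.TTheory GRing.Theory Num.Theory.

Local Open Scope classical_set_scope.
Local Open Scope ring_scope.

(** The four designs come from the Shephard-Todd groups number 16, 25 and 32 and
from the Coxeter group H4:
 - in dimension 2 over the complex numbers, 12 + 20 lines: the vertices of an
   icosahedron and of the dual dodecahedron in the projective line, with weights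
   5/168 and 9/280;
 - in complex dimension 3, 12 + 36 lines, with weights 1/60 and 1/45;
 - in complex dimension 4, 40 + 360 lines, with weights 1/280 and 1/420;
 - in real dimension 4, 60 + 300 lines through the vertices of a 600-cell and of
   the dual 120-cell, with weights 1/252 and 4/1575.

Since the group acts transitively on the lines of each orbit, the double sum that
defines a (t,t)-design reduces to its two rows at the base points
([frame_sum_const], [two_orbit_design]). What remains is finite exact arithmetic
in a number ring, spelled out as a certificate: generating reflections, one vector
on each line, and the permutation of these vectors (up to roots of unity) by each
generator. The certificate shows that the group is finite, that the orbits are as
listed, and that the two rows have the right sums ([design_of_certificate]).

The spherical 19-design comes from a general fact ([antipodal_spherical]): in
dimension at least 2 the antipodal double of a real (t,t)-design is a spherical
design of order 2t+1. The surface measure is invariant under rotations, because a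
rotation in a plane is a product of three shears and a shear preserves Lebesgue
measure by Fubini and translation invariance ([rotation_preserves]). Hence the
mean over the sphere of the k-th power of the form dot z depends only on k for unit
vectors z, and for k = 2t the expansion of this identity to second order in z yields
the value c_t ([mean_dot], [moment_even]). Let L be the difference between the
weighted sum over the design and the mean over the sphere. As
<x,y>^2t is the sum of x_f y_f over all words f of length 2t in the coordinates,
the sum of the L(x_f)^2 equals c_t - 2 c_t + c_t = 0, so that L kills all monomials
of degree 2t ([tt_design_word]). Lower even degrees follow by multiplication with
|x|^2 = 1, and odd monomials have weighted sum and mean zero. *)

(** * Reflections and orbits of lines *)

Section Inner.
Context (F : numFieldType) (conj : {rmorphism F -> F}) (d : nat).
Implicit Types x y r : 'cV[F]_d.
Local Notation inner := (@inner F conj d).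

Lemma innerBl x x' y : inner (x - x') y = inner x y - inner x' y.
Proof. by rewrite -sumrB; apply: eq_bigr => i _; rewrite !mxE mulrBl. Qed.

Lemma innerZl a x y : inner (a *: x) y = a * inner x y.
Proof. by rewrite mulr_sumr; apply: eq_bigr => i _; rewrite !mxE mulrA. Qed.

Lemma innerBr x y y' : inner x (y - y') = inner x y - inner x y'.
Proof.
by rewrite -sumrB; apply: eq_bigr => i _; rewrite !mxE rmorphB mulrBr.
Qed.

Lemma innerZr a x y : inner x (a *: y) = conj a * inner x y.
Proof.
by rewrite mulr_sumr; apply: eq_bigr => i _; rewrite !mxE rmorphM mulrCA.
Qed.

(** The reflection with root [r] and eigenvalue [1 - a * inner r r] on it; leaving
[a] free avoids dividing by the norm of the root. *)
Definition refl_mx r (a : F) : 'M[F]_d :=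
  1%:M - a *: (r *m (map_mx conj r)^T).

Lemma refl_mxE r a x : refl_mx r a *m x = x - (a * inner x r) *: r.
Proof.
rewrite mulmxBl mul1mx -scalemxAl -mulmxA -scalerA; congr (_ - _ *: _).
rewrite [X in _ *m X]mx11_scalar mul_mx_scalar; congr (_ *: _).
by rewrite mxE; apply: eq_bigr => i _; rewrite !mxE mulrC.
Qed.

Lemma mx_ext m (A B : 'M[F]_(m, d)) : (forall x : 'cV_d, A *m x = B *m x) -> A = B.
Proof.
move=> AB; apply/matrixP => i j; have /matrixP/(_ i 0) := AB (delta_mx j 0).
by rewrite -!colE !mxE.
Qed.

(** On the line of [r] the reflection is multiplication by [z], on its orthogonal
complement it is the identity. *)
Lemma refl_mxX r a z k : a * inner r r = 1 - z -> inner r r != 0 ->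
  refl_mx r a ^+ k = refl_mx r ((1 - z ^+ k) / inner r r).
Proof.
move=> arr nz; apply: mx_ext => x; rewrite refl_mxE.
elim: k => [|k IH] in x *.
  by rewrite expr0 subrr !mul0r scale0r subr0 mul1mx.
rewrite exprSr -mulmxA refl_mxE IH innerBl innerZl.
have -> : a = (1 - z) / inner r r by rewrite -arr mulfK.
rewrite -addrA -opprD -scalerDl; congr (_ - _ *: _).
rewrite exprS.
by field.
Qed.

Hypothesis conjK : involutive conj.

Lemma innerC x y : conj (inner x y) = inner y x.
Proof.
by rewrite rmorph_sum; apply: eq_bigr => i _; rewrite rmorphM conjK mulrC.
Qed.

Lemma refl_mx_isometric r a z x y : a * inner r r = 1 - z -> z * conj z = 1 ->
  inner r r != 0 ->
  inner (refl_mx r a *m x) (refl_mx r a *m y) = inner x y.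
Proof.
move=> arr zz nz; rewrite !refl_mxE !innerBl !innerBr !innerZl !innerZr.
rewrite -(innerC y r) !rmorphM /=.
have -> : conj a = (1 - conj z) / inner r r.
  by rewrite -[conj z]opprK -[1](rmorph1 conj) opprK -rmorphB -arr rmorphM innerC
             mulfK.
have -> : a = (1 - z) / inner r r by rewrite -arr mulfK.
suff -> : conj z = z^-1.
  have z0 : z != 0 by apply: contra_eq_neq zz => ->; rewrite mul0r eq_sym oner_eq0.
  by field; rewrite nz.
have z0 : z != 0 by apply: contra_eq_neq zz => ->; rewrite mul0r eq_sym oner_eq0.
by apply: (mulfI z0); rewrite zz divff.
Qed.

End Inner.

Section Lines.
Context (F : numFieldType) (d : nat).
Implicit Types x y : 'cV[F]_d.

Lemma line_self x : line x x.
Proof. by exists 1; rewrite ?scale1r. Qed.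

Lemma line_scale c x : c != 0 -> line (c *: x) = line x.
Proof.
move=> c0; apply/seteqP; split=> [_ [b _ <-]|_ [b _ <-]].
  by exists (b * c); rewrite // scalerA.
by exists (b / c); rewrite // scalerA mulfVK.
Qed.

Lemma line_eqP x y : x != 0 -> line x = line y ->
  exists2 c, c != 0 & x = c *: y.
Proof.
move=> x0 xy; have := line_self x; rewrite xy => -[c _ cy]; exists c => //.
by apply: contraNneq x0 => c0; rewrite -cy c0 scale0r.
Qed.

Lemma line_mulmx_inj (g : 'M[F]_d) x y : g \in unitmx -> x != 0 ->
  line (g *m x) = line (g *m y) -> line x = line y.
Proof.
move=> gu x0 gxy.
have gx0 : g *m x != 0.
  by apply: contraNneq x0 => gx; rewrite -[x](mulKmx gu) gx mulmx0.
have [c c0 e] := line_eqP gx0 gxy.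
by rewrite -[x](mulKmx gu) e -scalemxAr mulKmx // line_scale.
Qed.

End Lines.

Section GeneratedGroup.
Context (F : numFieldType) (d : nat).
Implicit Types (S P : set 'M[F]_d) (V : seq 'cV[F]_d).

Lemma generated_group_min S P : matrix_group P -> S `<=` P ->
  generated_group S `<=` P.
Proof. by move=> gP SP; exact: smallest_sub. Qed.

Lemma sub_generated_group S : S `<=` generated_group S.
Proof. exact: sub_smallest. Qed.

Lemma generated_group1 S : generated_group S 1%:M.
Proof. by move=> A [[A1 _ _] _]. Qed.

Lemma generated_groupM S g h :
  generated_group S g -> generated_group S h -> generated_group S (g *m h).
Proof.
by move=> Gg Gh A AS; case: (AS) => -[_ AM _] _; apply: AM; [exact: Gg|exact: Gh].
Qed.

(** Inverses stay in the stabilizer because an injective map of a finite set into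
itself is onto. *)
Lemma stabilizer_group V :
  matrix_group [set g | g \in unitmx /\ {in V, forall x, g *m x \in V}].
Proof.
split=> /= [|g h [gu gV] [hu hV]|g [gu gV]].
- by split=> [|x xV]; rewrite ?unitmx1 // mul1mx.
- by split=> [|x xV]; rewrite ?unitmx_mul ?gu // -mulmxA; apply/gV/hV.
split=> //; split=> [|x xV]; first by rewrite unitmx_inv.
have gI : injective (mulmx g : 'cV_d -> 'cV_d) by exact: can_inj (mulKmx gu).
have sub : {subset [seq g *m y | y <- undup V] <= undup V}.
  by move=> _ /mapP[y yV ->]; rewrite mem_undup gV // -mem_undup.
have us : uniq [seq g *m y | y <- undup V] by rewrite map_inj_uniq ?undup_uniq.
have [|_ E] := uniq_min_size us sub; first by rewrite size_map.
by have := xV; rewrite -mem_undup -E => /mapP[y yV ->]; rewrite mulKmx // -mem_undup.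
Qed.

Lemma isometry_group (conj : {rmorphism F -> F}) :
  matrix_group [set g : 'M[F]_d | g \in unitmx /\
    forall x y, inner conj (g *m x) (g *m y) = inner conj x y].
Proof.
split=> /= [|g h [gu gI] [hu hI]|g [gu gI]].
- by split=> [|x y]; rewrite ?unitmx1 ?mul1mx.
- by split=> [|x y]; rewrite ?unitmx_mul ?gu // -!mulmxA gI hI.
- by split=> //; split=> [|x y]; rewrite ?unitmx_inv // -gI !mulKVmx.
Qed.

End GeneratedGroup.

Section OrbitSystem.
Context (F : numFieldType) (d : nat) (J : finType) (gen : J -> 'M[F]_d).
Context (z : F) (m : nat).

(** A finite family of vectors, one on each line of an orbit. The generator [gen j]
permutes the family by [f j] up to powers of the root of unity [z], and every member
is reached from [a ord0] by a descending path of generators. *)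
Record orbit_system n (a : 'I_n.+1 -> 'cV[F]_d) (f : J -> 'I_n.+1 -> 'I_n.+1) : Prop :=
  OrbitSystem {
    orbit_perm : forall j, injective (f j);
    orbit_push : forall j i, exists k, gen j *m a i = z ^+ k *: a (f j i);
    orbit_tree : forall i, i != ord0 ->
      exists j (i' : 'I_n.+1), (i' < i)%N /\ f j i' = i;
    orbit_neq0 : forall i, a i != 0;
    orbit_apart : forall i, i != ord0 -> line (a ord0) <> line (a i) }.

Local Notation G := (generated_group (range gen)).

Hypotheses (m_gt0 : (0 < m)%N) (zm : z ^+ m = 1).
Hypothesis (gen_unit : forall j, gen j \in unitmx).

Lemma root_neq0 : z != 0.
Proof. by apply: contra_eq_neq zm => ->; rewrite expr0n gtn_eqF // eq_sym oner_eq0. Qed.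

Lemma norm_root (y : F) k : y ^+ m = 1 -> `|y ^+ k| = 1.
Proof.
move=> ym; suff y1 : `|y| = 1 by rewrite normrX y1 expr1n.
by apply/eqP; rewrite -(pexpr_eq1 m_gt0) // -normrX ym normr1.
Qed.

Section OneOrbit.
Context (n : nat) (a : 'I_n.+1 -> 'cV[F]_d) (f : J -> 'I_n.+1 -> 'I_n.+1).
Hypothesis af : orbit_system a f.

(** Induction from the base point along the generators, which is how transitivity
enters all later arguments. *)
Lemma orbit_ind (P : 'I_n.+1 -> Prop) :
  P ord0 -> (forall j i, P i -> P (f j i)) -> forall i, P i.
Proof.
move=> P0 Pf i; have [k] := ubnP (val i); elim: k i => // k IH i ik.
have [->//|i0] := eqVneq i ord0.
have [j [i' [i'i <-]]] := orbit_tree af i0; apply: Pf; apply: IH.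
exact: leq_trans i'i _.
Qed.

Definition orbit_vectors : seq 'cV[F]_d :=
  [seq z ^+ p.1 *: a p.2 | p : 'I_m * 'I_n.+1 <- enum {: 'I_m * 'I_n.+1}].

Lemma orbit_vectorsP x :
  reflect (exists k i, x = z ^+ k *: a i) (x \in orbit_vectors).
Proof.
apply: (iffP mapP) => [[[k i] _ ->]|[k [i ->]]]; first by exists k, i.
exists (Ordinal (ltn_pmod k m_gt0), i); rewrite ?mem_enum //=.
by rewrite {1}(divn_eq k m) exprD mulnC exprM zm expr1n mul1r.
Qed.

Lemma orbit_vectors_stable :
  G `<=` [set g | g \in unitmx /\
    {in orbit_vectors, forall x, g *m x \in orbit_vectors}].
Proof.
apply: generated_group_min; first exact: stabilizer_group.
move=> _ [j _ <-]; split=> //= x /orbit_vectorsP[k [i ->]].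
have [l e] := orbit_push af j i; apply/orbit_vectorsP; exists (k + l)%N, (f j i).
by rewrite -scalemxAr e scalerA exprD.
Qed.

Lemma orbit_image g i : G g -> exists k i', g *m a i = z ^+ k *: a i'.
Proof.
move=> /orbit_vectors_stable[_ gV]; apply/orbit_vectorsP/gV/orbit_vectorsP.
by exists 0%N, i; rewrite scale1r.
Qed.

Lemma orbit_reach i : exists2 g, G g & exists k, g *m a ord0 = z ^+ k *: a i.
Proof.
elim/orbit_ind: i => [|j i [g Gg [k gk]]].
  by exists 1%:M; [exact: generated_group1|exists 0%N; rewrite mul1mx scale1r].
exists (gen j *m g).
  by apply: generated_groupM => //; apply: sub_generated_group; exists j.
have [l e] := orbit_push af j i; exists (k + l)%N.
by rewrite -mulmxA gk -scalemxAr e scalerA exprD.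
Qed.

Lemma line_orbitE : line_orbit G (a ord0) = range (fun i => line (a i)).
Proof.
apply/seteqP; split=> [_ [g Gg <-]|_ [i _ <-]].
  have [k [i ->]] := orbit_image ord0 Gg.
  by exists i => //; rewrite line_scale // expf_neq0 // root_neq0.
have [g Gg [k e]] := orbit_reach i; exists g => //.
by rewrite e line_scale // expf_neq0 // root_neq0.
Qed.

(** It suffices that the line of the base point occurs once: the generators permute
the indices, so they carry the uniqueness from one member to the next. *)
Lemma orbit_line_inj : injective (fun i => line (a i)).
Proof.
move=> i; elim/orbit_ind: i => [i' /= e|j i IH i' /= e].
  by apply/eqP; rewrite eq_sym; apply/negP => /negP/(orbit_apart af); apply.
have /codomP[i'' di''] := injF_onto (orbit_perm af (j:=j)) i'.
rewrite di''; congr (f j _); apply: IH.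
have [k ek] := orbit_push af j i; have [l el] := orbit_push af j i''.
apply: (line_mulmx_inj (gen_unit j)); first exact: orbit_neq0 af i.
by rewrite ek el !line_scale ?expf_neq0 ?root_neq0 // -di''.
Qed.

(** An element of the group is determined by the images of multiples of the basis
vectors, and these images lie in a finite list. *)
Lemma spanning_finite :
  (forall k, exists i c, c != 0 /\ a i = c *: delta_mx k 0) -> finite_set G.
Proof.
move=> span.
have /choice[ic icP] : forall k, exists ic : 'I_n.+1 * F,
    ic.2 != 0 /\ a ic.1 = ic.2 *: delta_mx k 0.
  by move=> k; have [i [c ?]] := span k; exists (i, c).
pose T := {ffun 'I_d -> 'I_(size orbit_vectors)}.
pose mat (h : T) : 'M[F]_d :=
  \matrix_(r, k) ((ic k).2^-1 * (tnth (in_tuple orbit_vectors) (h k)) r 0).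
apply: (@sub_finite_set _ _ (mat @` [set: T])); last first.
  exact/finite_image/finite_finset.
move=> g /orbit_vectors_stable[_ gV].
have aV k : g *m a (ic k).1 \in orbit_vectors.
  by apply/gV/orbit_vectorsP; exists 0%N, (ic k).1; rewrite scale1r.
exists [ffun k => Ordinal (etrans (index_mem _ _) (aV k))] => //.
apply/matrixP => r k; rewrite mxE ffunE (tnth_nth 0) /= nth_index //.
have [c0 ->] := icP k.
by rewrite -scalemxAr -colE !mxE mulKf.
Qed.

End OneOrbit.

Section Frame.
Context (conj : {rmorphism F -> F}).
Hypothesis gen_isometric : forall j x y,
  inner conj (gen j *m x) (gen j *m y) = inner conj x y.
Context (n : nat) (a : 'I_n.+1 -> 'cV[F]_d) (f : J -> 'I_n.+1 -> 'I_n.+1).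
Hypothesis af : orbit_system a f.
Context (n' : nat) (b : 'I_n'.+1 -> 'cV[F]_d) (f' : J -> 'I_n'.+1 -> 'I_n'.+1).
Hypothesis bf : orbit_system b f'.

(** Moving [a i] by a generator permutes the terms of the sum, because the generator
is an isometry and permutes the lines of the [b l]. *)
Lemma frame_sum_const e i :
  \sum_l `|inner conj (a i) (b l)| ^+ e = \sum_l `|inner conj (a ord0) (b l)| ^+ e.
Proof.
elim/(orbit_ind af): i => // j i IH.
rewrite -[RHS]IH (reindex_inj (orbit_perm bf (j:=j))); apply: eq_bigr => l _.
rewrite -[inner conj (a i) _](gen_isometric j).
have [k ->] := orbit_push af j i; have [k' ->] := orbit_push bf j l.
rewrite innerZl innerZr !normrM rmorphXn !norm_root ?mul1r //.
by rewrite -rmorphXn zm rmorph1.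
Qed.
End Frame.

End OrbitSystem.

Lemma inner_gt0 (F : numFieldType) (conj : {rmorphism F -> F}) d (x : 'cV[F]_d) :
  (forall a, `|a| ^+ 2 = a * conj a) -> x != 0 -> 0 < inner conj x x.
Proof.
move=> normK x0; rewrite lt_def sumr_ge0 ?andbT; last first.
  by move=> i _; rewrite -normK exprn_ge0.
apply: contra_neq x0 => s0; apply/matrixP => i j; rewrite ord1 mxE.
move/psumr_eq0P: s0 => /(_ _ i isT) e; apply/eqP.
rewrite -normr_eq0 -sqrf_eq0 normK e // => k _.
by rewrite -normK exprn_ge0.
Qed.

Section TwoOrbits.
Context (F : numFieldType) (conj : {rmorphism F -> F}) (d : nat).
Hypotheses (conjK : involutive conj)
  (normK : forall a : F, `|a| ^+ 2 = a * conj a)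
  (has_sqrt : forall a : F, 0 <= a -> exists r : F, `|r| ^+ 2 = a).
Context (J : finType) (gen : J -> 'M[F]_d) (z : F) (m : nat).
Hypotheses (m_gt0 : (0 < m)%N) (zm : z ^+ m = 1).
Hypotheses (gen_refl : forall j, reflection (gen j))
  (gen_unit : forall j, gen j \in unitmx)
  (gen_isometric : forall j x y,
    inner conj (gen j *m x) (gen j *m y) = inner conj x y).
Local Notation G := (generated_group (range gen)).

Section Apart.
Context (n : nat) (a : 'I_n.+1 -> 'cV[F]_d) (f : J -> 'I_n.+1 -> 'I_n.+1).
Hypothesis af : orbit_system gen z a f.
Context (n' : nat) (b : 'I_n'.+1 -> 'cV[F]_d) (f' : J -> 'I_n'.+1 -> 'I_n'.+1).
Hypothesis bf : orbit_system gen z b f'.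

Lemma orbit_sqnorm i : inner conj (a i) (a i) = inner conj (a ord0) (a ord0).
Proof.
elim/(orbit_ind af): i => // j i <-; rewrite -[RHS](gen_isometric j).
have [k ->] := orbit_push af j i.
rewrite innerZl innerZr mulrA -normK (norm_root m_gt0 _ zm) //.
by rewrite expr1n mul1r.
Qed.

Lemma orbit_line_apart : (forall l, line (a ord0) <> line (b l)) ->
  forall i l, line (a i) <> line (b l).
Proof.
move=> ab i; elim/(orbit_ind af): i => // j i IH l.
have /codomP[l' ->] := injF_onto (orbit_perm bf (j:=j)) l.
have [k ek] := orbit_push af j i; have [k' ek'] := orbit_push bf j l'.
move=> e; apply: (IH l'); apply: (line_mulmx_inj (gen_unit j)).
  exact: orbit_neq0 af i.
by rewrite ek ek' !line_scale ?expf_neq0 // (root_neq0 m_gt0 zm).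
Qed.

End Apart.

Context (n : nat) (a : 'I_n.+1 -> 'cV[F]_d) (f : J -> 'I_n.+1 -> 'I_n.+1).
Hypothesis af : orbit_system gen z a f.
Context (n' : nat) (b : 'I_n'.+1 -> 'cV[F]_d) (f' : J -> 'I_n'.+1 -> 'I_n'.+1).
Hypothesis bf : orbit_system gen z b f'.
Hypothesis span : forall k, exists i c, c != 0 /\ a i = c *: delta_mx k 0.
Hypothesis apart : forall l, line (a ord0) <> line (b l).
Context (t : nat) (c w1 w2 : F).
Hypotheses (w1_gt0 : 0 < w1) (w2_gt0 : 0 < w2).
Hypothesis wsum : n.+1%:R * w1 + n'.+1%:R * w2 = 1.
Local Notation S x y := (\sum_l `|inner conj x (y l)| ^+ (2 * t)).
Local Notation N x := (inner conj x x ^+ t).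
Hypothesis frame :
  n.+1%:R * (w1 * w1 * S (a ord0) a / (N (a ord0) * N (a ord0)) +
             w1 * w2 * S (a ord0) b / (N (a ord0) * N (b ord0))) +
  n'.+1%:R * (w2 * w1 * S (b ord0) a / (N (b ord0) * N (a ord0)) +
              w2 * w2 * S (b ord0) b / (N (b ord0) * N (b ord0))) = c.

(** The points are the vectors of the two families, scaled to length 1. The
hypothesis [frame] is the design equation after summing the equal rows of each
orbit. *)
Lemma two_orbit_design : exists (G : set 'M[F]_d) X w,
  [/\ finite_isometric_reflection_group conj G,
      weighted_union_of_two_orbits G X w,
      spherical_tt_design conj c t X w &
      num_lines X = (n.+1 + n'.+1)%N].
Proof.
have na_gt0 := inner_gt0 normK (orbit_neq0 af ord0).
have nb_gt0 := inner_gt0 normK (orbit_neq0 bf ord0).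
have [r1 r1K] := has_sqrt (ltW na_gt0); have [r2 r2K] := has_sqrt (ltW nb_gt0).
have r1_neq0 : r1 != 0.
  by rewrite -normr_eq0 -sqrf_eq0 r1K gt_eqF.
have r2_neq0 : r2 != 0.
  by rewrite -normr_eq0 -sqrf_eq0 r2K gt_eqF.
pose I := ('I_n.+1 + 'I_n'.+1)%type.
pose u (k : I) := match k with inl i => r1^-1 *: a i | inr i => r2^-1 *: b i end.
have u_inj k k' : line (u k) = line (u k') -> k = k'.
  case: k k' => [i|i] [i'|i'] /=; rewrite !line_scale ?invr_eq0 //.
  - by move/(orbit_line_inj m_gt0 zm gen_unit af) => ->.
  - by move/(orbit_line_apart af bf apart).
  - by move/esym/(orbit_line_apart af bf apart).
  - by move/(orbit_line_inj m_gt0 zm gen_unit bf) => ->.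
have u_uniq : uniq (codom u).
  by apply/injectiveP => k k' /(congr1 (@line _ _))/u_inj.
pose X := [fset x in codom u]%fset.
pose w x := if x \in codom (u \o inl) then w1 else w2.
have XP x : reflect (exists k, x = u k) (x \in X).
  by rewrite inE; exact: codomP.
have wl i : w (u (inl i)) = w1.
  by rewrite /w (_ : _ \in _ = true) //; apply/codomP; exists i.
have wr i : w (u (inr i)) = w2.
  rewrite /w; case: codomP => // -[i' /= e].
  by have /u_inj := congr1 (@line _ _) (e : u (inr i) = u (inl i')).
have sumX (h : 'cV[F]_d -> F) : \sum_(x <- X) h x =
    \sum_i h (u (inl i)) + \sum_i h (u (inr i)).
  have pX : perm_eq (enum_fset X) (codom u).
    by apply: uniq_perm => // x; rewrite inE.
  by rewrite (perm_big _ pX) big_image /= big_sumType.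
have innerZ r r' x y :
    `|inner conj (r^-1 *: x) (r'^-1 *: y)| ^+ (2 * t) =
    `|inner conj x y| ^+ (2 * t) / ((`|r| ^+ 2) ^+ t * (`|r'| ^+ 2) ^+ t).
  have conj_norm v : `|conj v| = `|v|.
    apply/eqP; rewrite -(eqrXn2 (n:=2)) // !normK conjK mulrC //.
  rewrite -!exprM innerZl innerZr !normrM conj_norm !normfV !exprMn !exprVn.
  by rewrite invfM mulrA mulrC.
exists G, X, w; split.
- split; first exact: (spanning_finite m_gt0 zm gen_unit af span).
    by exists (range gen) => // _ [j _ <-].
  move=> g Gg x y.
  have [|_ ->//] := generated_group_min (isometry_group d conj) _ Gg.
  by move=> _ [j _ <-].
- have linel i : line (u (inl i)) = line (a i) by rewrite /= line_scale ?invr_eq0.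
  have liner i : line (u (inr i)) = line (b i) by rewrite /= line_scale ?invr_eq0.
  have Ga := line_orbitE m_gt0 zm gen_unit af.
  have Gb := line_orbitE m_gt0 zm gen_unit bf.
  exists (a ord0), (b ord0); split.
  + by split; [exact: orbit_neq0 af _|exact: orbit_neq0 bf _].
  + move=> e; have : line_orbit G (a ord0) (line (a ord0)) by rewrite Ga; exists ord0.
    by rewrite e Gb => -[l _ /esym]; exact: apart.
  + by move=> x y /XP[k ->] /XP[k' ->] /u_inj ->.
  + rewrite Ga Gb; apply/seteqP; split=> [_ [_ /XP[[i|i] ->] <-]|l].
    * by left; exists i.
    * by right; exists i.
    * case=> -[i _ <-].
        by exists (u (inl i)) => //; apply/XP; exists (inl i).
      by exists (u (inr i)) => //; apply/XP; exists (inr i).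
  + move=> y yab _ _ /XP[k ->] /XP[k' ->] yk yk'.
    case: yab yk yk' => ->; rewrite ?Ga ?Gb => -[i _ ei] [i' _ ei'].
      have <- : inl i = k by apply: u_inj; rewrite linel.
      have <- : inl i' = k' by apply: u_inj; rewrite linel.
      by rewrite !wl.
    have <- : inr i = k by apply: u_inj; rewrite liner.
    have <- : inr i' = k' by apply: u_inj; rewrite liner.
    by rewrite !wr.
- split; first split.
  + move=> _ /XP[[i|i] ->] /=; rewrite innerZl innerZr mulrA -normK normfV exprVn.
      by rewrite r1K (orbit_sqnorm af) mulVf ?gt_eqF.
    by rewrite r2K (orbit_sqnorm bf) mulVf ?gt_eqF.
  + by move=> _ /XP[[i|i] ->]; rewrite ?wl ?wr.
  + rewrite sumX (eq_bigr _ (fun i _ => wl i)) (eq_bigr _ (fun i _ => wr i)).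
    by rewrite !sumr_const !card_ord -wsum !mulr_natl.
  rewrite sumX -frame; congr (_ + _).
    rewrite mulr_natl -[X in _ *+ X](card_ord n.+1) -sumr_const.
    apply: eq_bigr => i _; rewrite sumX wl /=; congr (_ + _).
      rewrite -(frame_sum_const m_gt0 zm gen_isometric af af _ i) -!mulrA.
      rewrite mulrA mulr_suml mulr_sumr; apply: eq_bigr => l _.
      by rewrite wl innerZ r1K.
    rewrite -(frame_sum_const m_gt0 zm gen_isometric af bf _ i) -!mulrA.
    rewrite mulrA mulr_suml mulr_sumr; apply: eq_bigr => l _.
    by rewrite wr innerZ r1K r2K.
  rewrite mulr_natl -[X in _ *+ X](card_ord n'.+1) -sumr_const.
  apply: eq_bigr => i _; rewrite sumX wr /=; congr (_ + _).
    rewrite -(frame_sum_const m_gt0 zm gen_isometric bf af _ i) -!mulrA.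
    rewrite mulrA mulr_suml mulr_sumr; apply: eq_bigr => l _.
    by rewrite wl innerZ r1K r2K.
  rewrite -(frame_sum_const m_gt0 zm gen_isometric bf bf _ i) -!mulrA.
  rewrite mulrA mulr_suml mulr_sumr; apply: eq_bigr => l _.
  by rewrite wr innerZ r2K.
- rewrite /num_lines card_in_imfset /=; last first.
    by move=> x y /XP[k ->] /XP[k' ->] /u_inj ->.
  by rewrite /X card_fseq undup_id ?size_codom ?card_sum ?card_ord.
Qed.

End TwoOrbits.

(** * Exact arithmetic in number rings *)

(** Operations to compute with, without any axioms: all algebraic laws are used only
after evaluation in a field (see [kembed]). The test [knz] is sufficient for an
element to be nonzero there, and [kdiv] is exact division by an integer whenever
that is possible. *)
Record kring := KRing {
  kcar :> Type;
  kofZ : Z -> kcar;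
  kadd : kcar -> kcar -> kcar;
  kopp : kcar -> kcar;
  kmul : kcar -> kcar -> kcar;
  kconj : kcar -> kcar;
  keq : kcar -> kcar -> bool;
  knz : kcar -> bool;
  kdiv : kcar -> Z -> kcar }.

Delimit Scope Z_scope with BZ.
Declare Scope kring_scope.
Delimit Scope kring_scope with K.
Bind Scope kring_scope with kcar.
Notation "x + y" := (kadd x y) : kring_scope.
Notation "- x" := (kopp x) : kring_scope.
Notation "x - y" := (kadd x (kopp y)) : kring_scope.
Notation "x * y" := (kmul x y) : kring_scope.
Notation "x == y" := (keq x y) : kring_scope.

Fixpoint kexp (K : kring) (x : K) (n : nat) : K :=
  if n is n'.+1 then (x * kexp x n')%K else kofZ _ 1.

Definition Zring : kring :=
  @KRing Z id Z.add Z.opp Z.mul id Z.eqb (fun z => negb (Z.eqb z 0)) Z.div.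

(** The extension of [K] by a root t of t^2 = p t + q whose conjugate is [tbar]; the
pair (a, b) stands for a + b t. Nonvanishing is tested on the norm to [K]. *)
Definition quad (K : kring) (p q : K) (tbar : K * K) : kring :=
  let mulq (x y : K * K) :=
    let b := (x.2 * y.2)%K in
    ((x.1 * y.1 + q * b)%K, (x.1 * y.2 + x.2 * y.1 + p * b)%K) in
  let addq (x y : K * K) := ((x.1 + y.1)%K, (x.2 + y.2)%K) in
  @KRing (K * K)%type
    (fun z => (kofZ K z, kofZ K 0))
    addq
    (fun x => (kopp x.1, kopp x.2))
    mulq
    (fun x => addq (kconj x.1, kofZ K 0) (mulq (kconj x.2, kofZ K 0) tbar))
    (fun x y => if keq x.1 y.1 then keq x.2 y.2 else false)
    (fun x => knz (x.1 * x.1 + p * (x.1 * x.2) - q * (x.2 * x.2))%K)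
    (fun x z => (kdiv x.1 z, kdiv x.2 z)).

(** * Checkable certificates *)

Section Compute.
Variable (K : kring) (d : nat).
Implicit Types (x y r : seq K) (L : seq (seq K)).

Definition entry x i : K := nth (kofZ K 0) x i.

Definition ksum (T : Type) (s : seq T) (f : T -> K) : K :=
  foldr (fun i a => (f i + a)%K) (kofZ K 0) s.

Definition kinner x y : K :=
  ksum (iota 0 d) (fun i => entry x i * kconj (entry y i))%K.

Definition ksqnorm x y : K := let a := kinner x y in (a * kconj a)%K.

Definition kveq x y : bool :=
  foldr (fun i b => if (entry x i == entry y i)%K then b else false)
    true (iota 0 d).

Definition kscale (a : K) x : seq K :=
  map (fun i => a * entry x i)%K (iota 0 d).

(** The reflection x |-> x - (coef / denom) <x, root> root. It has order [korder] and
multiplies the root by [keigen]. *)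
Record krefl := KRefl {
  kroot : seq K; kcoef : K; kdenom : Z; keigen : K; korder : nat }.

(** The image of [x] times [kdenom g], which needs no division. *)
Definition kmove (g : krefl) x : seq K :=
  let a := (kcoef g * kinner x (kroot g))%K in
  map (fun i => kofZ K (kdenom g) * entry x i - a * entry (kroot g) i)%K
    (iota 0 d).

Definition krefl_ok (g : krefl) : bool :=
  let n := kinner (kroot g) (kroot g) in
  [&& (kcoef g * n == (kofZ _ 1 - keigen g) * kofZ _ (kdenom g))%K,
      knz (kofZ K (kdenom g)), knz n,
      (kexp (keigen g) (korder g) == kofZ _ 1)%K, (0 < korder g)%N &
      (keigen g * kconj (keigen g) == kofZ _ 1)%K].

Variables (gens : seq krefl) (zeta : K) (m : nat).

Definition kaxis (i : nat) x : bool :=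
  knz (entry x i) &&
  all (fun j => (j == i) || (entry x j == kofZ K 0)%K) (iota 0 d).

(** [kpush] lists for each generator and each point number i the pair (i', k) such
that the generator maps point i to [zeta ^ k] times point i'. [ktree] lists for
point number i+1 a pair (j, i') with i' <= i such that generator j moves point i' to
point i+1. *)
Record korbit := KOrbit {
  kpoints : seq (seq K);
  kpush : seq (seq (nat * nat));
  ktree : seq (nat * nat) }.

Definition kpoint (o : korbit) i := nth [::] (kpoints o) i.
Definition kimage (o : korbit) j i := nth (0, 0)%N (nth [::] (kpush o) j) i.
Definition kgen j := nth (KRefl [::] (kofZ K 0) 0 (kofZ K 0) 0) gens j.

(** That each generator permutes the indices is tested by iterating its index map as
often as the order of the reflection, which must give the identity. *)
Definition kpush_ok (o : korbit) : bool :=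
  let n := size (kpoints o) in
  all (fun j => let g := kgen j in
    all (fun i => let p := kimage o j i in
      [&& (p.1 < n)%N, iter (korder g) (fun i => (kimage o j i).1) i == i &
          kveq (kmove g (kpoint o i))
            (kscale (kofZ K (kdenom g) * kexp zeta p.2)%K (kpoint o p.1))])
      (iota 0 n))
    (iota 0 (size gens)).

Definition ktree_ok (o : korbit) : bool :=
  all (fun i => let p := nth (0, 0)%N (ktree o) i in
    [&& (p.2 <= i)%N, (p.1 < size gens)%N & (kimage o p.1 p.2).1 == i.+1])
    (iota 0 (size (kpoints o)).-1).

(** Strict Cauchy-Schwarz: the two vectors are not proportional. *)
Definition kapart x y : bool :=
  knz (kinner x x * kinner y y - ksqnorm x y)%K.

Definition korbit_ok (n : nat) (o : korbit) : bool :=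
  [&& size (kpoints o) == n.+1,
      all (fun x => knz (kinner x x)) (kpoints o),
      all (kapart (kpoint o 0)) (behead (kpoints o)),
      kpush_ok o & ktree_ok o].

Definition kspanning (o : korbit) : bool :=
  all (fun i => has (kaxis i) (kpoints o)) (iota 0 d).

Definition kframe t x (o : korbit) : K :=
  ksum (kpoints o) (fun y => kexp (ksqnorm x y) t).

Definition kprod (s : seq nat) : K :=
  foldr (fun a b => kofZ K (Z.of_nat a) * b)%K (kofZ K 1) s.

(** The design equation for the weights [p1 / q] and [p2 / q], with right-hand side
the quotient of the products of [A] and [B], after clearing all denominators. *)
Definition two_orbit_sum t (p1 p2 q : nat) (A B : seq nat) (o1 o2 : korbit) : bool :=
  let Z n := kofZ K (Z.of_nat n) in
  let x1 := kpoint o1 0 in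
  let x2 := kpoint o2 0 in
  let n1 := kexp (kinner x1 x1) t in
  let n2 := kexp (kinner x2 x2) t in
  let N1 := Z (size (kpoints o1)) in
  let N2 := Z (size (kpoints o2)) in
  (kprod B * (N1 * (Z p1 * Z p1 * (n2 * n2) * kframe t x1 o1
               + Z p1 * Z p2 * (n1 * n2) * kframe t x1 o2)
        + N2 * (Z p1 * Z p2 * (n1 * n2) * kframe t x2 o1
               + Z p2 * Z p2 * (n1 * n1) * kframe t x2 o2)) ==
   kprod A * (Z q * Z q) * (n1 * n1 * (n2 * n2)))%K.

(** The orbits have [n1.+1] and [n2.+1] lines. *)
Definition design_ok (t p1 p2 q : nat) (A B : seq nat) (n1 n2 : nat)
    (o1 o2 : korbit) : bool :=
  [&& (0 < m)%N, (kexp zeta m == kofZ K 1)%K, all krefl_ok gens,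
      korbit_ok n1 o1, korbit_ok n2 o2, kspanning o1,
      all (kapart (kpoint o1 0)) (kpoints o2) &
      [&& (0 < p1)%N, (0 < p2)%N, (n1.+1 * p1 + n2.+1 * p2 == q)%N,
          all (leq 1) B & two_orbit_sum t p1 p2 q A B o1 o2]].

(** The following search produces certificates. Nothing is proved about it, since its
output is checked. *)

Definition multiples (i : nat) x : seq (seq K * (nat * nat)) :=
  mkseq (fun k => (kscale (kexp zeta k) x, (i, k))) m.

Fixpoint find_multiple x (T : seq (seq K * (nat * nat))) :=
  if T is p :: T' then
    if kveq x p.1 then Some p.2 else find_multiple x T'
  else None.

Definition kact (g : krefl) x : seq K :=
  map (fun c => kdiv c (kdenom g)) (kmove g x).

(** Breadth-first search. [T] lists the multiples by powers of [zeta] of the [N] points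
found so far, and [i] is the number of the point at the head of [todo]. *)
Fixpoint orbit_search (fuel i : nat) (todo : seq (seq K)) N T :
    seq (seq K) * seq (nat * nat) * seq (seq K * (nat * nat)) :=
  if fuel is f.+1 then
    if todo is x :: todo' then
      let step acc j :=
        let: (new, N, tree, T) := acc in
        let y := kact (kgen j) x in
        if find_multiple y T is Some _ then acc
        else (rcons new y, N.+1, rcons tree (j, i), T ++ multiples N y) in
      let: (new, N', tree, T') :=
        foldl step ([::], N, [::], T) (iota 0 (size gens)) in
      let: (pts, tree', T'') := orbit_search f i.+1 (todo' ++ new) N' T' in
      (x :: pts, tree ++ tree', T'')
    else ([::], [::], T)
  else ([::], [::], T).

Definition search_orbit fuel x : korbit :=
  let: (pts, tree, T) := orbit_search fuel 0 [:: x] 1 (multiples 0 x) in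
  KOrbit pts
    [seq [seq odflt (0, 0)%N (find_multiple (kact g x) T) | x <- pts]
      | g <- gens] tree.

End Compute.

Section Embeddings.
Context (F : numFieldType) (conj : {rmorphism F -> F}).

(** A ring homomorphism to [F], compatible with conjugation. *)
Record kembed (K : kring) := KEmbed {
  kev :> K -> F;
  kevZ : forall z, kev (kofZ K z) = (int_of_Z z)%:~R;
  kevD : forall x y, kev (x + y)%K = kev x + kev y;
  kevN : forall x, kev (- x)%K = - kev x;
  kevM : forall x y, kev (x * y)%K = kev x * kev y;
  kevC : forall x, kev (kconj x) = conj (kev x);
  kev_eq : forall x y, (x == y)%K -> kev x = kev y;
  kev_nz : forall x, knz x -> kev x != 0 }.

Definition Zembed : kembed Zring.
Proof.
exists (fun z : Z => (int_of_Z z)%:~R : F) => //=.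
- by move=> x y; rewrite -intrD -rmorphD.
- by move=> x; rewrite -mulrNz -rmorphN.
- by move=> x y; rewrite -intrM -rmorphM.
- by move=> x; rewrite rmorph_int.
- by move=> x y /Z.eqb_spec ->.
- move=> x /negP x0; rewrite intr_eq0; apply/eqP => e; apply: x0.
  by rewrite -[x]int_of_ZK e.
Defined.

Lemma quad_embed K (e : kembed K) (p q : K) tbar (tau : F)
  (tau2 : tau ^+ 2 = e p * tau + e q)
  (tauC : conj tau = e tbar.1 + e tbar.2 * tau) :
  {f : kembed (quad p q tbar) | forall x y, f (x, y) = e x + e y * tau}.
Proof.
have M (x1 x2 y1 y2 : F) : x1 * y1 + e q * (x2 * y2) +
    (x1 * y2 + x2 * y1 + e p * (x2 * y2)) * tau =
    (x1 + x2 * tau) * (y1 + y2 * tau).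
  apply/eqP; rewrite -subr_eq0.
  rewrite [X in X == _](_ : _ = (x2 * y2) * (e p * tau + e q - tau ^+ 2)); last by ring.
  by rewrite tau2 subrr mulr0.
unshelve eexists; first exists (fun x : K * K => e x.1 + e x.2 * tau) => //=.
- by move=> z; rewrite !kevZ mul0r addr0.
- by move=> x y; rewrite !kevD; ring.
- by move=> x; rewrite !kevN; ring.
- by move=> x y; rewrite !(kevD, kevM) M.
- move=> x; rewrite !(kevD, kevM, kevC, kevZ) rmorphD rmorphM /= tauC.
  by rewrite !(mul0r, mulr0, addr0, add0r); ring.
- move=> [x1 x2] [y1 y2] /=; case: ifP => // /(kev_eq e)-> /(kev_eq e)->.
  by [].
- move=> [x1 x2] /= /(kev_nz e); rewrite !(kevD, kevM, kevN) => nz.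
  apply: contraNneq nz => x0; rewrite (_ : _ - _ =
    (e x1 + e x2 * tau) * (e x1 + e x2 * (e p - tau)) +
    e x2 ^+ 2 * (tau ^+ 2 - (e p * tau + e q))).
    by rewrite x0 mul0r tau2 subrr mulr0 addr0.
  by ring.
- by [].
Qed.

End Embeddings.

Section Soundness.
Context (F : numFieldType) (conj : {rmorphism F -> F}).
Hypotheses (conjK : involutive conj)
  (normK : forall a : F, `|a| ^+ 2 = a * conj a)
  (has_sqrt : forall a : F, 0 <= a -> exists r : F, `|r| ^+ 2 = a).
Context (K : kring) (e : kembed conj K) (d : nat).
Implicit Types x y : seq K.

Lemma kev1 : e (kofZ K 1) = 1.
Proof. by rewrite kevZ. Qed.

Lemma kev_exp (x : K) n : e (kexp x n) = e x ^+ n.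
Proof. by elim: n => /= [|n IH]; rewrite ?kev1 // kevM IH exprS. Qed.

Lemma kev_sum T (s : seq T) f : e (ksum s f) = \sum_(i <- s) e (f i).
Proof.
by elim: s => /= [|i s IH]; rewrite ?big_nil ?big_cons ?kevZ // kevD IH.
Qed.

Definition kvec x : 'cV[F]_d := \col_(i < d) e (entry x i).

Lemma entry_iota (f : nat -> K) i : (i < d)%N -> entry (map f (iota 0 d)) i = f i.
Proof. by move=> id; rewrite /entry (nth_map 0%N) ?size_iota // nth_iota. Qed.

Lemma kvec_scale a x : kvec (kscale d a x) = e a *: kvec x.
Proof. by apply/matrixP => i j; rewrite !mxE entry_iota // kevM. Qed.

Lemma kvec_eq x y : kveq d x y -> kvec x = kvec y.
Proof.
have E s : foldr (fun i b => if (entry x i == entry y i)%K then b else false)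
    true s = all (fun i => entry x i == entry y i)%K s.
  by elim: s => //= i s ->; case: (_ == _)%K.
rewrite /kveq E => /allP xy; apply/matrixP => i j; rewrite !mxE.
by apply/(kev_eq e)/xy; rewrite mem_iota add0n ltn_ord.
Qed.

Lemma kev_inner x y : e (kinner d x y) = inner conj (kvec x) (kvec y).
Proof.
have iotaE : iota 0 d = index_iota 0 d by rewrite /index_iota subn0.
rewrite /kinner kev_sum iotaE big_mkord; apply: eq_bigr => i _.
by rewrite !mxE kevM kevC.
Qed.

Lemma kev_sqnorm x y : e (ksqnorm d x y) = `|inner conj (kvec x) (kvec y)| ^+ 2.
Proof. by rewrite kevM kevC kev_inner normK. Qed.

(** Proportional vectors satisfy equality in Cauchy-Schwarz. *)
Lemma kapartP x y : kapart d x y -> line (kvec x) <> line (kvec y).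
Proof.
move=> /(kev_nz e); rewrite kevD kevM kevN !kev_inner kev_sqnorm normK => nz xy.
have := line_self (kvec x); rewrite xy => -[c _ cy].
move/negP: nz; apply; apply/eqP.
by rewrite -cy !innerZl !innerZr rmorphM innerC //; ring.
Qed.

Definition kmx (g : krefl K) : 'M[F]_d :=
  refl_mx conj (kvec (kroot g)) (e (kcoef g) / e (kofZ K (kdenom g))).

Section Reflection.
Context (g : krefl K).
Hypothesis g_ok : krefl_ok d g.

Let denom_neq0 : e (kofZ K (kdenom g)) != 0.
Proof. by case/and5P: g_ok => _ /(kev_nz e). Qed.

Lemma kvec_move x :
  kvec (kmove d g x) = e (kofZ K (kdenom g)) *: (kmx g *m kvec x).
Proof.
rewrite refl_mxE scalerBr scalerA; apply/matrixP => i j.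
rewrite !mxE entry_iota // !(kevD, kevM, kevN, kev_inner).
by congr (_ - _); rewrite !mulrA [X in X * _]mulrC mulrC; field.
Qed.

Let root_neq0 : inner conj (kvec (kroot g)) (kvec (kroot g)) != 0.
Proof. by case/and5P: g_ok => _ _ /(kev_nz e); rewrite kev_inner. Qed.

Let coefE : e (kcoef g) / e (kofZ K (kdenom g)) *
  inner conj (kvec (kroot g)) (kvec (kroot g)) = 1 - e (keigen g).
Proof.
case/and5P: g_ok => /(kev_eq e) + _ _ _ _.
rewrite !(kevM, kevD, kevN) kev_inner kev1 => E.
by apply: (mulIf denom_neq0); rewrite mulrAC mulfVK // E.
Qed.

Lemma korder_gt0 : (0 < korder g)%N.
Proof. by case/and5P: g_ok => _ _ _ _ /andP[]. Qed.

Lemma kmxX : kmx g ^+ korder g = 1%:M.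
Proof.
rewrite (refl_mxX _ coefE) //; case/and5P: g_ok => _ _ _ /(kev_eq e) + _.
by rewrite kev_exp kev1 => ->; rewrite subrr mul0r /refl_mx scale0r subr0.
Qed.

Lemma kmx_unit : kmx g \in unitmx.
Proof.
have := kmxX; case: (korder g) korder_gt0 => // k _; rewrite exprS => E.
by have [] := mulmx1_unit E.
Qed.

Lemma kmx_reflection : reflection (kmx g).
Proof.
split; first by exists (korder g); [exact: korder_gt0|exact: kmxX].
exists (map_mx conj (kvec (kroot g)))^T.
  apply: contra_neq root_neq0 => r0.
  have /matrixP/(_ 0 0) := congr1 (mulmx^~ (kvec (kroot g))) r0.
  rewrite mul0mx !mxE => E; rewrite -[RHS]E.
  by apply: eq_bigr => i _; rewrite !mxE mulrC.
move=> x hx; rewrite /kmx mulmxBl mul1mx -scalemxAl -mulmxA hx mulmx0 scaler0.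
by rewrite subr0.
Qed.

Lemma kmx_isometric (x y : 'cV_d) :
  inner conj (kmx g *m x) (kmx g *m y) = inner conj x y.
Proof.
apply: (refl_mx_isometric conjK _ _ coefE) => //.
by case/and5P: g_ok => _ _ _ _ /andP[_ /(kev_eq e)]; rewrite kevM kevC kev1.
Qed.

End Reflection.

Section Generators.
Context (gens : seq (krefl K)) (zeta : K).
Hypothesis gens_ok : all (krefl_ok d) gens.
Let gen (j : 'I_(size gens)) := kmx (kgen gens j).

Let gen_ok (j : 'I_(size gens)) : krefl_ok d (kgen gens j).
Proof. exact: all_nthP gens_ok _ (ltn_ord j). Qed.

Section Orbit.
Context (n : nat) (o : korbit K).
Hypothesis o_ok : korbit_ok d gens zeta n o.

Let a (i : 'I_n.+1) := kvec (kpoint o i).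
Let f (j : 'I_(size gens)) (i : 'I_n.+1) : 'I_n.+1 := inord (kimage o j i).1.

Let size_o : size (kpoints o) = n.+1.
Proof. by case/and5P: o_ok => /eqP. Qed.

Let push_ok (j : 'I_(size gens)) (i : 'I_n.+1) :
  [&& ((kimage o j i).1 < n.+1)%N,
      iter (korder (kgen gens j)) (fun i => (kimage o j i).1) i == i &
      kveq d (kmove d (kgen gens j) (kpoint o i))
        (kscale d (kofZ K (kdenom (kgen gens j)) * kexp zeta (kimage o j i).2)%K
          (kpoint o (kimage o j i).1))].
Proof.
case/and5P: o_ok => _ _ _ /allP/(_ j) + _; rewrite mem_iota add0n ltn_ord.
by move=> /(_ isT)/allP/(_ i); rewrite size_o mem_iota add0n ltn_ord; apply.
Qed.

Let fE j i : f j i = (kimage o j i).1 :> nat.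
Proof. by rewrite inordK //; case/andP: (push_ok j i). Qed.

Lemma korbit_system : orbit_system gen (e zeta) a f.
Proof.
split.
- move=> j; have iterf k i :
      iter k (f j) i = iter k (fun i => (kimage o j i).1) i :> nat.
    by elim: k => //= k IH; rewrite fE IH.
  have fK i : iter (korder (kgen gens j)) (f j) i = i.
    by apply/ord_inj; rewrite iterf; case/and3P: (push_ok j i) => _ /eqP.
  move=> i i' fii'; rewrite -(fK i) -(fK i').
  by case: (korder _) (korder_gt0 (gen_ok j)) => // k _; rewrite !iterSr fii'.
- move=> j i; exists (kimage o j i).2.
  case/and3P: (push_ok j i) => _ _ /kvec_eq.
  rewrite kvec_move ?kvec_scale ?gen_ok // kevM kev_exp -scalerA.
  rewrite /a fE; apply: scalerI.
  by case/and5P: (gen_ok j) => _ /(kev_nz e).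
- move=> i i0; have i_gt0 : (0 < i)%N by rewrite lt0n.
  case/and5P: o_ok => _ _ _ _ /allP/(_ i.-1).
  rewrite mem_iota size_o add0n /= -ltnS prednK // ltn_ord => /(_ isT).
  set p := nth _ _ _ => /and3P[p2 p1 /eqP pi].
  have p2n : (p.2 < n.+1)%N.
    exact: leq_ltn_trans p2 (leq_ltn_trans (leq_pred _) (ltn_ord i)).
  exists (Ordinal p1), (Ordinal p2n); split=> /=; first by rewrite -ltnS prednK in p2 *.
  by apply/ord_inj; rewrite fE /= pi.
- move=> i; case/and5P: o_ok => _ /(all_nthP [::])/(_ i) + _ _ _.
  rewrite size_o ltn_ord => /(_ isT)/(kev_nz e); rewrite kev_inner.
  rewrite -/(kpoint o i) -/(a i).
  by apply: contra_neq => ->; rewrite /inner big1 // => k _; rewrite mxE mul0r.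
- move=> i i0; case/and5P: o_ok => _ _ /(all_nthP [::])/(_ i.-1) + _ _.
  have i_gt0 : (0 < i)%N by rewrite lt0n.
  rewrite size_behead size_o -ltnS prednK // ltn_ord nth_behead prednK //.
  by move=> /(_ isT)/kapartP.
Qed.

Lemma kev_frame t x :
  e (kframe d t x o) = \sum_(l < n.+1) `|inner conj (kvec x) (a l)| ^+ (2 * t).
Proof.
rewrite /kframe kev_sum (big_nth [::]) size_o big_mkord; apply: eq_bigr => l _.
by rewrite kev_exp kev_sqnorm exprM.
Qed.

Lemma kspanningP : kspanning d o ->
  forall k, exists i c, c != 0 /\ a i = c *: delta_mx k 0.
Proof.
move=> /allP span k; have := span k; rewrite mem_iota add0n ltn_ord => /(_ isT).
case/(has_nthP [::]) => i; rewrite size_o => ii /andP[xk /allP xj].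
exists (Ordinal ii), (e (entry (kpoint o i) k)); split; first exact: kev_nz.
apply/matrixP => l l'; rewrite !mxE ord1 eqxx andbT; have [->|lk] := eqVneq l k.
  by rewrite mulr1.
have := xj l; rewrite mem_iota add0n ltn_ord => /(_ isT).
by rewrite val_eqE (negPf lk) /= mulr0 => /(kev_eq e)->; rewrite kevZ.
Qed.

End Orbit.
End Generators.

Theorem design_of_certificate (gens : seq (krefl K)) (zeta : K)
    (m t p1 p2 q : nat) (A B : seq nat) (n1 n2 : nat) (o1 o2 : korbit K) (c : F) :
  design_ok d gens zeta m t p1 p2 q A B n1 n2 o1 o2 ->
  c * \prod_(b <- B) b%:R = \prod_(a <- A) a%:R ->
  exists (G : set 'M[F]_d) X w,
  [/\ finite_isometric_reflection_group conj G,
      weighted_union_of_two_orbits G X w,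
      spherical_tt_design conj c t X w &
      num_lines X = (n1.+1 + n2.+1)%N].
Proof.
case/and5P=> m_gt0 /(kev_eq e) zm gens_ok ok1 /and4P[ok2 span /(all_nthP [::]) apart].
case/and5P=> p1_gt0 p2_gt0 /eqP pq B0 /(kev_eq e) sum cE.
have gen_ok (j : 'I_(size gens)) : krefl_ok d (kgen gens j).
  exact: all_nthP gens_ok _ (ltn_ord j).
have sys1 := korbit_system gens_ok ok1; have sys2 := korbit_system gens_ok ok2.
have q_neq0 : q%:R != 0 :> F by rewrite pnatr_eq0 -lt0n -pq addn_gt0 muln_gt0 p1_gt0.
have B_neq0 : \prod_(b <- B) b%:R != 0 :> F.
  by rewrite prodf_seq_neq0; apply: sub_all B0 => b; rewrite pnatr_eq0 -lt0n.
apply: (two_orbit_design conjK normK has_sqrt (z := e zeta) m_gt0 _ _ _ _ sys1 sys2 _ _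
  (w1 := p1%:R / q%:R) (w2 := p2%:R / q%:R)).
- by rewrite -kev_exp zm kev1.
- by move=> j; exact: kmx_reflection.
- by move=> j; exact: kmx_unit.
- by move=> j x y; exact: kmx_isometric.
- exact: kspanningP ok1 span.
- move=> l; apply/kapartP/apart.
  by case/and5P: ok2 => /eqP->.
- by rewrite divr_gt0 ?ltr0n // -pq addn_gt0 muln_gt0 p1_gt0.
- by rewrite divr_gt0 ?ltr0n // -pq addn_gt0 muln_gt0 p1_gt0.
- by rewrite !mulrA -mulrDl -!natrM -natrD pq divff.
have n1_neq0 : inner conj (kvec (kpoint o1 0)) (kvec (kpoint o1 0)) != 0.
  by rewrite gt_eqF // inner_gt0 //; exact: orbit_neq0 sys1 ord0.
have n2_neq0 : inner conj (kvec (kpoint o2 0)) (kvec (kpoint o2 0)) != 0.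
  by rewrite gt_eqF // inner_gt0 //; exact: orbit_neq0 sys2 ord0.
have natE n : (int_of_Z (Z.of_nat n))%:~R = n%:R :> F.
  rewrite -[RHS]/((Posz n)%:~R); congr (_%:~R).
  by case: n => //= n; rewrite SuccNat2Pos.id_succ.
have prodE s : e (kprod K s) = \prod_(a <- s) a%:R.
  elim: s => [|a s IH]; first by rewrite big_nil kev1.
  by rewrite big_cons /= kevM kevZ natE IH.
move: sum; rewrite !(kevM, kevD, prodE, kev_exp, kevZ, kev_inner, natE).
rewrite !(kev_frame ok1, kev_frame ok2) -cE.
case/and5P: (ok1) => /eqP-> _ _ _ _; case/and5P: (ok2) => /eqP-> _ _ _ _.
move: n1_neq0 n2_neq0 => /(expf_neq0 t) + /(expf_neq0 t).
rewrite /=; set N1 := _ ^+ t; set N2 := _ ^+ t.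
set S1 := \sum_(l < _) _; set S2 := \sum_(l < _) _.
set S3 := \sum_(l < _) _; set S4 := \sum_(l < _) _.
move=> N1_neq0 N2_neq0 E.
apply: (mulfI B_neq0); apply: (mulIf q_neq0); apply: (mulIf q_neq0).
apply: (mulIf N1_neq0); apply: (mulIf N2_neq0);
apply: (mulIf N1_neq0); apply: (mulIf N2_neq0).
transitivity (\prod_(b <- B) b%:R * (n1.+1%:R * (p1%:R * p1%:R * (N2 * N2) * S1 +
   p1%:R * p2%:R * (N1 * N2) * S2) +
   n2.+1%:R * (p1%:R * p2%:R * (N1 * N2) * S3 +
   p2%:R * p2%:R * (N1 * N1) * S4))).
  move: q_neq0 N1_neq0 N2_neq0 {E cE B_neq0 zm pq}.
  move: (\prod_(b <- B) b%:R) n1.+1%:R n2.+1%:R p1%:R p2%:R q%:R N1 N2 S1 S2 S3 S4.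
  move=> b m1 m2 u1 u2 v M1 M2 T1 T2 T3 T4 v0 M10 M20.
  by field; rewrite v0 M10 M20.
by rewrite E; ring.
Qed.

End Soundness.

(** * The four designs *)

(** The integers of Q(sqrt 5), generated by the golden ratio phi. *)
Definition Zphi : kring := quad (K := Zring) 1%BZ 1%BZ (0%BZ, 1%BZ).
Definition gold (a b : Z) : Zphi := (a, b).

(** The Eisenstein integers, generated by a primitive third root of unity omega. *)
Definition Zomega : kring := quad (K := Zring) (-1)%BZ (-1)%BZ (-1, -1)%BZ.
Definition eis (a b : Z) : Zomega := (a, b).

(** A primitive fifth root of unity eps has eps + eps^-1 = phi - 1, hence
eps^2 = (phi - 1) eps - 1. *)
Definition Zeps : kring :=
  quad (K := Zphi) (gold (-1) 1) (gold (-1) 0) (gold (-1) 1, gold (-1) 0).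
Definition Zepsomega : kring :=
  quad (K := Zeps) (kofZ _ (-1)) (kofZ _ (-1)) (kofZ _ (-1), kofZ _ (-1)).

Lemma Zphi_embed (F : numFieldType) (conj : {rmorphism F -> F}) (s : F) :
  s ^+ 2 = 5 -> conj s = s -> {e : kembed conj Zphi | forall a b,
    e (gold a b) = (int_of_Z a)%:~R + (int_of_Z b)%:~R * ((1 + s) / 2)}.
Proof.
move=> s2 sC.
have t2 : ((1 + s) / 2) ^+ 2 =
    Zembed conj 1%BZ * ((1 + s) / 2) + Zembed conj 1%BZ.
  rewrite /= mulr1z mul1r; apply/eqP; rewrite -subr_eq0.
  rewrite [X in X == _](_ : _ = (s ^+ 2 - 5) / 4); last by field.
  by rewrite s2 subrr mul0r.
have tC : conj ((1 + s) / 2) =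
    Zembed conj 0%BZ + Zembed conj 1%BZ * ((1 + s) / 2).
  by rewrite /= mulr1z mul1r add0r fmorph_div rmorphD rmorph1 rmorph_nat sC.
have [e eE] := quad_embed (K := Zring) (tbar := (0%BZ, 1%BZ)) t2 tC.
by exists e => a b; rewrite eE.
Qed.

Section ComplexEmbeddings.
Context (R : realType).
Local Notation C := R[i].
Local Notation conjC := (Num.conj : {rmorphism C -> C}).

(** A root of the quadratic polynomial whose other root is its conjugate. *)
Lemma quad_root (s D : C) : s^* = s -> 0 <= D ->
  exists t : C, t ^+ 2 = s * t - (s ^+ 2 + D) / 4 /\ t^* = s - t.
Proof.
move=> sC D0; have dC : (sqrtC D)^* = sqrtC D by apply: geC0_conj; rewrite sqrtC_ge0.
exists ((s + 'i * sqrtC D) / 2); split.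
  apply/eqP; rewrite -subr_eq0.
  rewrite [X in X == _](_ : _ = (sqrtC D ^+ 2 * 'i ^+ 2 + D) / 4); last by field.
  by rewrite sqrCi sqrtCK mulrN1 addNr mul0r.
by rewrite fmorph_div rmorphD rmorphM /= sC dC conjCi rmorph_nat; field.
Qed.

Lemma omega_exists : exists t : C, t ^+ 2 = - t - 1 /\ t^* = -1 - t.
Proof.
have [||t [t2 tC]] := @quad_root (-1) 3; rewrite ?rmorphN1 ?ler0n //.
by exists t; split=> //; rewrite t2; field.
Qed.

Lemma Zomega_embed : kembed conjC Zomega.
Proof.
have [t [t2 tC]] := cid omega_exists.
have [||e _] := @quad_embed _ conjC _ (Zembed conjC) (-1)%BZ (-1)%BZ (-1, -1)%BZ t.
- by rewrite t2 /= mulrN1z mulN1r.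
- by apply: (etrans tC); rewrite /= mulrN1z mulN1r.
exact: e.
Qed.

Lemma Zepsomega_embed : kembed conjC Zepsomega.
Proof.
have s2 : (sqrtC 5 : C) ^+ 2 = 5 by rewrite sqrtCK.
have s0 : 0 <= (sqrtC 5 : C) by rewrite sqrtC_ge0 ler0n.
have [e eE] := Zphi_embed (conj := conjC) s2 (geC0_conj s0).
have [t' [t2' tC']] := cid omega_exists.
have sE : e (gold (-1) 1) = (sqrtC 5 - 1) / 2.
  by rewrite eE mulrN1z mulr1z mul1r; field.
have nE : e (gold (-1) 0) = -1.
  by rewrite eE mulrN1z mulr0z mul0r addr0.
have [||t [t2 tC]] := cid (@quad_root (e (gold (-1) 1)) ((5 + sqrtC 5) / 2) _ _).
- by rewrite sE fmorph_div rmorphB rmorph1 rmorph_nat /= geC0_conj.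
- by rewrite divr_ge0 ?addr_ge0 ?ler0n.
have [||e' _] := @quad_embed _ conjC _ e (gold (-1) 1) (gold (-1) 0)
    (gold (-1) 1, gold (-1) 0) t.
- rewrite t2 nE; congr (_ + _); rewrite sE; apply/eqP; rewrite -subr_eq0.
  rewrite [X in X == _](_ : _ = (5 - sqrtC 5 ^+ 2) / 16); last by field.
  by rewrite sqrtCK subrr mul0r.
- by apply: (etrans tC); rewrite /= nE mulN1r.
have [||e'' _] := @quad_embed _ conjC _ e' (kofZ _ (-1)) (kofZ _ (-1))
    (kofZ _ (-1), kofZ _ (-1)) t'.
- by rewrite t2' !kevZ /= mulrN1z mulN1r.
- by apply: (etrans tC'); rewrite /= !kevZ /= mulrN1z mulN1r.
exact: e''.
Qed.

Lemma complex_normK (a : C) : `|a| ^+ 2 = a * conjC a.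
Proof. exact: normCK. Qed.

Lemma complex_sqrt (a : C) : 0 <= a -> exists r : C, `|r| ^+ 2 = a.
Proof.
by move=> a0; exists (sqrtC a); rewrite ger0_norm ?sqrtCK // sqrtC_ge0.
Qed.

End ComplexEmbeddings.

Section G16.
Local Notation ZZ := (kofZ Zepsomega).
Let emb (a : Zeps) : Zepsomega := (a, kofZ _ 0).
Let omega : Zepsomega := (kofZ _ 0, kofZ _ 1).
Let phi : Zepsomega := emb (gold 0 1, gold 0 0).
Let eps : Zepsomega := emb (gold 0 0, gold 1 0).
Let sqrt5 : Zepsomega := (phi + phi - ZZ 1)%K.

(** The second root has squared norm 3 - phi = 5 / (2 + phi). *)
Definition gens_G16 : seq (krefl Zepsomega) :=
  [:: KRefl [:: ZZ 1; ZZ 0] (ZZ 1 - eps)%K 1 eps 5;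
      KRefl [:: ZZ 1; (ZZ 1 - phi)%K] ((ZZ 1 - eps) * (ZZ 2 + phi))%K 5 eps 5].

Definition root30 : Zepsomega := (- (omega * eps))%K.

(** The factor sqrt 5 keeps the whole orbit integral. *)
Definition orbit12_G16 := Eval vm_compute in
  search_orbit 2 gens_G16 root30 30 20 [:: sqrt5; ZZ 0].

(** The base point is an eigenvector of the product of the two generators, which acts
on the projective line as a rotation of order 3. *)
Definition orbit20_G16 := Eval vm_compute in
  search_orbit 2 gens_G16 root30 30 30
    [:: (ZZ 1 - eps)%K; (sqrt5 * (omega * omega) + (ZZ 1 - eps) * phi)%K].

End G16.

(** 25 / 840 = 5 / 168 and 27 / 840 = 9 / 280. *)
Lemma G16_ok : design_ok 2 gens_G16 root30 30 9 25 27 840 [::] [:: 10] 11 19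
  orbit12_G16 orbit20_G16.
Proof. by vm_compute. Qed.

Theorem design_C2 (R : realType) :
  exists (G : set 'M[R[i]]_2) (X : {fset 'cV[R[i]]_2}) (w : 'cV[R[i]]_2 -> R[i]),
    [/\ finite_complex_reflection_group G,
        weighted_union_of_two_orbits G X w,
        complex_tt_design 9 X w & num_lines X = 32%N].
Proof.
apply: (design_of_certificate conjCK (@complex_normK R) (@complex_sqrt R)
  (Zepsomega_embed R) G16_ok).
by rewrite big_seq1 big_nil /c_complex mulVf ?pnatr_eq0.
Qed.

(** The reflections of order 3 with the given roots; the second component of each pair
is 3 (1 - omega) divided by the squared norm of the root. *)
Definition eisenstein_reflections (roots : seq (seq Zomega * Zomega)) :=
  [seq KRefl p.1 p.2 3 (eis 0 1) 3 | p <- roots].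

Definition gens_G25 : seq (krefl Zomega) := eisenstein_reflections
  [:: ([:: eis 1 0; eis 0 0; eis 0 0], eis 3 (-3));
      ([:: eis 1 0; eis 1 0; eis 1 0], eis 1 (-1));
      ([:: eis 0 0; eis 0 0; eis 1 0], eis 3 (-3))].

(** The sixth root of unity is 1 + omega. The base points are multiplied by
1 + 2 omega = sqrt (-3) to keep the orbits integral. *)
Definition orbit12_G25 := Eval vm_compute in
  search_orbit 3 gens_G25 (eis 1 1) 6 20 [:: eis 1 2; eis 0 0; eis 0 0].

Definition orbit36_G25 := Eval vm_compute in
  search_orbit 3 gens_G25 (eis 1 1) 6 40 [:: eis 0 0; eis 1 2; eis 1 2].

(** 3 / 180 = 1 / 60 and 4 / 180 = 1 / 45. *)
Lemma G25_ok : design_ok 3 gens_G25 (eis 1 1) 6 4 3 4 180 [::] [:: 15] 11 35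
  orbit12_G25 orbit36_G25.
Proof. by vm_compute. Qed.

Theorem design_C3 (R : realType) :
  exists (G : set 'M[R[i]]_3) (X : {fset 'cV[R[i]]_3}) (w : 'cV[R[i]]_3 -> R[i]),
    [/\ finite_complex_reflection_group G,
        weighted_union_of_two_orbits G X w,
        complex_tt_design 4 X w & num_lines X = 48%N].
Proof.
apply: (design_of_certificate conjCK (@complex_normK R) (@complex_sqrt R)
  (Zomega_embed R) G25_ok).
by rewrite big_seq1 big_nil /c_complex mulVf ?pnatr_eq0.
Qed.

Definition gens_G32 : seq (krefl Zomega) := eisenstein_reflections
  [:: ([:: eis 1 0; eis 0 0; eis 0 0; eis 0 0], eis 3 (-3));
      ([:: eis 1 0; eis 1 0; eis 1 0; eis 0 0], eis 1 (-1));
      ([:: eis 0 0; eis 0 0; eis 1 0; eis 0 0], eis 3 (-3));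
      ([:: eis 0 0; eis 1 0; eis (-1) 0; eis 1 0], eis 1 (-1))].

Definition orbit40_G32 := Eval vm_compute in
  search_orbit 4 gens_G32 (eis 1 1) 6 50
    [:: eis 1 2; eis 0 0; eis 0 0; eis 0 0].

Definition orbit360_G32 := Eval vm_compute in
  search_orbit 4 gens_G32 (eis 1 1) 6 400
    [:: eis 1 2; eis 1 2; eis 0 0; eis 0 0].

(** 3 / 840 = 1 / 280 and 2 / 840 = 1 / 420. *)
Lemma G32_ok : design_ok 4 gens_G32 (eis 1 1) 6 5 3 2 840 [::] [:: 56] 39 359
  orbit40_G32 orbit360_G32.
Proof. by vm_compute. Qed.

Theorem design_C4 (R : realType) :
  exists (G : set 'M[R[i]]_4) (X : {fset 'cV[R[i]]_4}) (w : 'cV[R[i]]_4 -> R[i]),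
    [/\ finite_complex_reflection_group G,
        weighted_union_of_two_orbits G X w,
        complex_tt_design 5 X w & num_lines X = 400%N].
Proof.
apply: (design_of_certificate conjCK (@complex_normK R) (@complex_sqrt R)
  (Zomega_embed R) G32_ok).
by rewrite big_seq1 big_nil /c_complex mulVf ?pnatr_eq0.
Qed.

(** All four roots have squared norm 4, hence the denominator 2. *)
Definition gens_H4 : seq (krefl Zphi) :=
  [seq KRefl r (gold 1 0) 2 (gold (-1) 0) 2 |
    r <- [:: [:: gold 2 0; gold 0 0; gold 0 0; gold 0 0];
             [:: gold 0 0; gold 0 0; gold 2 0; gold 0 0];
             [:: gold 1 0; gold 1 0; gold 1 0; gold 1 0];
             [:: gold 0 1; gold 1 0; gold (-1) 1; gold 0 0]]].

Definition orbit60_H4 := Eval vm_compute in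
  search_orbit 4 gens_H4 (gold (-1) 0) 2 70
    [:: gold 2 0; gold 0 0; gold 0 0; gold 0 0].

Definition orbit300_H4 := Eval vm_compute in
  search_orbit 4 gens_H4 (gold (-1) 0) 2 400
    [:: gold 0 0; gold 0 0; gold 2 0; gold 2 0].

(** 25 / 6300 = 1 / 252 and 16 / 6300 = 4 / 1575. *)
Lemma H4_ok : design_ok 4 gens_H4 (gold (-1) 0) 2 9 25 16 6300
  [:: 1; 3; 5; 7; 9; 11; 13; 15; 17] [:: 4; 6; 8; 10; 12; 14; 16; 18; 20] 59 299
  orbit60_H4 orbit300_H4.
Proof. by vm_compute. Qed.

Theorem design_R4 (R : realType) :
  exists (G : set 'M[R]_4) (X : {fset 'cV[R]_4}) (w : 'cV[R]_4 -> R),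
    [/\ finite_real_reflection_group G,
        weighted_union_of_two_orbits G X w,
        real_tt_design 9 X w & num_lines X = 360%N].
Proof.
have [|//|e _] := @Zphi_embed R (idfun : {rmorphism R -> R}) (Num.sqrt 5).
  by rewrite sqr_sqrtr ?ler0n.
have conjK : involutive (idfun : {rmorphism R -> R}) by [].
have normK (a : R) : `|a| ^+ 2 = a * (idfun : {rmorphism R -> R}) a.
  by rewrite real_normK ?num_real.
have has_sqrt (a : R) : 0 <= a -> exists r : R, `|r| ^+ 2 = a.
  by move=> a0; exists (Num.sqrt a); rewrite real_normK ?num_real ?sqr_sqrtr.
apply: (design_of_certificate conjK normK has_sqrt e H4_ok).
rewrite /c_real !big_ord_recr !big_ord0 !big_cons !big_nil /=.
by rewrite !muln0 !muln1; field.
Qed.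

(** * Rotations preserve Lebesgue measure *)

Section MeasurePreserving.
Context (R : realType).

Definition preserves d (T : measurableType d) (mu : set T -> \bar R)
    (f : T -> T) :=
  measurable_fun [set: T] f /\
  forall A, measurable A -> mu (f @^-1` A) = mu A.

Lemma preserves_comp d (T : measurableType d) (mu : set T -> \bar R) f g :
  preserves mu f -> preserves mu g -> preserves mu (f \o g).
Proof.
move=> [mf pf] [mg pg]; split; first exact: measurableT_comp.
move=> A mA; rewrite comp_preimage pg ?pf //.
by rewrite -[X in measurable X]setTI; exact: mf.
Qed.

Lemma lebesgue_translation (a : R) :
  preserves (@lebesgue_measure R) (fun x => x + a).
Proof.
have mf : measurable_fun [set: measurableTypeR R]
    (fun x => x + a : measurableTypeR R) by apply: measurable_funD.
split=> // A mA; apply/esym.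
pose mu : {measure set (measurableTypeR R) -> \bar R} :=
  measure_function_pushforward__canonical__measure_function_Measure
    (@lebesgue_measure R) mf.
apply: (@lebesgue_measure_unique R mu) => // _ [[x y] _ <-] /=.
rewrite /pushforward /=.
have -> : (fun z => z + a) @^-1` `]x, y] = `](x - a), (y - a)]%classic.
  by apply/seteqP; split=> z /=; rewrite !in_itv /= ltrBlDr lerBrDr.
rewrite !lebesgue_measure_itv /= !lte_fin ltrD2r; case: ifP => // _.
by congr (_%:E); ring.
Qed.

Section Shear.
Context d1 d2 (T1 : measurableType d1) (T2 : measurableType d2).
Context (m1 : {sigma_finite_measure set T1 -> \bar R})
        (m2 : {sigma_finite_measure set T2 -> \bar R}).

(** By Fubini: the section of the preimage at [x] is the preimage of the section under
[f x]. *)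
Lemma shear_preserves2 (f : T1 -> T2 -> T2) :
  measurable_fun [set: T1 * T2] (fun p => f p.1 p.2) ->
  (forall x, preserves m2 (f x)) ->
  preserves (m1 \x m2)%E (fun p => (p.1, f p.1 p.2)).
Proof.
move=> mf pf; split.
  by apply: measurable_fun_pair => /=; [exact: measurable_fst|exact: mf].
move=> A mA; apply: eq_integral => x _ /=.
rewrite -((pf x).2 (xsection A x)); last exact: measurable_xsection.
by congr (m2 _); apply/seteqP; split=> y; rewrite /xsection /= !inE.
Qed.

Lemma shear_preserves1 (f : T2 -> T1 -> T1) :
  measurable_fun [set: T1 * T2] (fun p => f p.2 p.1) ->
  (forall y, preserves m1 (f y)) ->
  preserves (m1 \x m2)%E (fun p => (f p.2 p.1, p.2)).
Proof.
move=> mf pf.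
have mg : measurable_fun [set: T1 * T2] (fun p => (f p.2 p.1, p.2)).
  by apply: measurable_fun_pair => /=; [exact: mf|exact: measurable_snd].
have E B : measurable B -> (m1 \x m2)%E B = (\int[m2]_y m1 (ysection B y))%E.
  move=> mB; have := indic_fubini_tonelli m1 m2 mB.
  by rewrite (indic_fubini_tonelli_FE m2 mB) (indic_fubini_tonelli_GE m1 mB).
split=> // A mA; rewrite !E //; last first.
  by rewrite -[X in measurable X]setTI; exact: mg.
apply: eq_integral => y _ /=.
rewrite -((pf y).2 (ysection A y)); last exact: measurable_ysection.
by congr (m1 _); apply/seteqP; split=> x; rewrite /ysection /= !inE.
Qed.

End Shear.

Local Notation Rvec d := (d.-tuple (measurableTypeR R)).

(** Transport along the identification that defines [lebesgue_vec]. *)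
Lemma preserves_cons d (f : measurableTypeR R * Rvec d -> measurableTypeR R * Rvec d)
    (g : Rvec d.+1 -> Rvec d.+1) :
  preserves (@lebesgue_measure R \x @lebesgue_vec R d)%E f ->
  (forall p, g (cons_vec p) = cons_vec (f p)) ->
  preserves (@lebesgue_vec R d.+1) g.
Proof.
move=> [mf pf] gf.
have mc : measurable_fun setT (@cons_vec R d) by exact: measurable_cons.
pose h (v : Rvec d.+1) : measurableTypeR R * Rvec d :=
  (thead v, [tuple of behead v]).
have mh : measurable_fun setT h.
  apply: measurable_fun_pair => /=; first exact: measurable_tnth.
  exact: measurable_behead.
have hK v : cons_vec (h v) = v by rewrite [RHS]tuple_eta.
have gE : g = @cons_vec R d \o f \o h.
  by apply/funext => v /=; rewrite -gf hK.
split; first by rewrite gE; apply: measurableT_comp => //; exact: measurableT_comp.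
move=> A mA.
have E : @cons_vec R d @^-1` (g @^-1` A) = f @^-1` (@cons_vec R d @^-1` A).
  by apply/seteqP; split=> p; rewrite /preimage /= gf.
rewrite /= /pushforward E pf //.
by rewrite -[X in measurable X]setTI; exact: mc.
Qed.

Definition translate d (a v : Rvec d) : Rvec d :=
  [tuple tnth v i + tnth a i | i < d].

Lemma lebesgue_vec_translation d (a : Rvec d) :
  preserves (@lebesgue_vec R d) (translate a).
Proof.
elim: d a => [|d IH] a.
  have E : translate a = id by apply/funext => v; rewrite [v]tuple0; exact: tuple0.
  by rewrite E; split.
have mt (v : Rvec d) : measurable_fun [set: measurableTypeR R * Rvec d]
    (fun p => translate v p.2).
  apply/measurable_fun_tnthP => i.
  rewrite (_ : _ \o _ = fun p => tnth p.2 i + tnth v i); last first.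
    by apply/funext => p; rewrite /= tnth_mktuple.
  apply: measurable_funD => //; apply: (measurableT_comp (measurable_tnth i)).
  exact: measurable_snd.
have p1 := @shear_preserves1 _ _ _ _ (@lebesgue_measure R) (@lebesgue_vec R d)
  (fun _ x => x + thead a).
have p2 := @shear_preserves2 _ _ _ _ (@lebesgue_measure R) (@lebesgue_vec R d)
  (fun _ v => translate [tuple of behead a] v).
apply: (preserves_cons (preserves_comp (p1 _ _) (p2 _ _))).
- by apply: measurable_funD => //; exact: measurable_fst.
- by move=> _; exact: lebesgue_translation.
- exact: mt.
- by move=> _; exact: IH.
move=> [x v] /=; apply: eq_from_tnth => i; rewrite tnth_mktuple.
have [j ->|->] := unliftP ord0 i.
  by rewrite !tnthS tnth_mktuple [a in LHS]tuple_eta tnthS.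
by rewrite !tnth0 [a in LHS]tuple_eta tnth0.
Qed.

End MeasurePreserving.

Section Rotation.
Context (R : realType).
Local Notation Rvec d := (d.-tuple (measurableTypeR R)).

Definition dot d (u v : Rvec d) : R := \sum_i tnth u i * tnth v i.
Definition scale d (r : R) (v : Rvec d) : Rvec d := [tuple r * tnth v i | i < d].

Lemma tnth_scale d r (v : Rvec d) i : tnth (scale r v) i = r * tnth v i.
Proof. by rewrite tnth_mktuple. Qed.

Lemma tnth_translate d (a v : Rvec d) i : tnth (translate a v) i = tnth v i + tnth a i.
Proof. by rewrite tnth_mktuple. Qed.

Lemma tnth_cons0 d (x : R) (v : Rvec d) : tnth (cons_vec (x, v)) ord0 = x.
Proof. by rewrite tnth0. Qed.

Lemma tnth_consS d (x : R) (v : Rvec d) i :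
  tnth (cons_vec (x, v)) (lift ord0 i) = tnth v i.
Proof. by rewrite tnthS. Qed.

Lemma dot_cons d x y (u v : Rvec d) :
  dot (cons_vec (x, u)) (cons_vec (y, v)) = x * y + dot u v.
Proof.
rewrite /dot big_ord_recl !tnth_cons0; congr (_ + _).
by apply: eq_bigr => i _; rewrite !tnth_consS.
Qed.

Lemma dot_translate d (u a v : Rvec d) : dot u (translate a v) = dot u v + dot u a.
Proof.
by rewrite -big_split; apply: eq_bigr => i _; rewrite tnth_translate mulrDr.
Qed.

Lemma dot_scale d (u v : Rvec d) r : dot u (scale r v) = r * dot u v.
Proof.
by rewrite mulr_sumr; apply: eq_bigr => i _; rewrite tnth_scale mulrCA.
Qed.

Lemma dotC d (u v : Rvec d) : dot u v = dot v u.
Proof. by apply: eq_bigr => i _; rewrite mulrC. Qed.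

Lemma measurable_dot d (u : Rvec d) : measurable_fun setT (dot u).
Proof.
apply: measurable_sum => i; apply: measurable_funM => //.
exact: measurable_tnth.
Qed.

Section PlaneRotation.
Context (d : nat) (c : R) (s : Rvec d).

Definition shear_head (p : measurableTypeR R * Rvec d) :
    measurableTypeR R * Rvec d :=
  (p.1 + (1 + c)^-1 * dot s p.2, p.2).

Definition shear_tail (p : measurableTypeR R * Rvec d) :
    measurableTypeR R * Rvec d :=
  (p.1, translate (scale (- p.1) s) p.2).

Definition uncons_vec (v : Rvec d.+1) : measurableTypeR R * Rvec d :=
  (thead v, [tuple of behead v]).

Lemma cons_vecK p : uncons_vec (cons_vec p) = p.
Proof. by case: p => x v; rewrite /uncons_vec theadE; congr pair; exact/val_inj. Qed.

Lemma uncons_vecK v : cons_vec (uncons_vec v) = v.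
Proof. by rewrite [RHS]tuple_eta. Qed.

(** For c = cos theta and |s| = sin theta this is the rotation by theta in the plane of
the first basis vector and s, as a product of three shears; the factor 1 / (1 + c) is
tan (theta / 2) / sin theta. *)
Definition rotation (v : Rvec d.+1) : Rvec d.+1 :=
  cons_vec (shear_head (shear_tail (shear_head (uncons_vec v)))).

Lemma rotation_preserves : preserves (@lebesgue_vec R d.+1) rotation.
Proof.
have mfst := @measurable_fst _ _ (measurableTypeR R) (Rvec d).
have msnd := @measurable_snd _ _ (measurableTypeR R) (Rvec d).
have ph : preserves (@lebesgue_measure R \x @lebesgue_vec R d)%E shear_head.
  apply: (@shear_preserves1 _ _ _ _ _ (@lebesgue_measure R) (@lebesgue_vec R d)
    (fun v x => x + (1 + c)^-1 * dot s v)).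
    apply: measurable_funD => //; apply: measurable_funM => //.
    exact: measurableT_comp (measurable_dot s) msnd.
  by move=> v; exact: lebesgue_translation.
have pt : preserves (@lebesgue_measure R \x @lebesgue_vec R d)%E shear_tail.
  apply: (@shear_preserves2 _ _ _ _ _ (@lebesgue_measure R) (@lebesgue_vec R d)
    (fun x v => translate (scale (- x) s) v)).
    apply/measurable_fun_tnthP => i.
    rewrite (_ : _ \o _ = fun p => tnth p.2 i + - p.1 * tnth s i); last first.
      by apply/funext => p; rewrite /= tnth_translate tnth_scale.
    apply: measurable_funD; first exact: measurableT_comp (measurable_tnth i) msnd.
    by apply: measurable_funM => //; exact: measurable_funN.
  by move=> x; exact: lebesgue_vec_translation.
apply: (preserves_cons (preserves_comp ph (preserves_comp pt ph))) => p.
by rewrite /rotation cons_vecK.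
Qed.

Hypotheses (c1 : 1 + c != 0) (unit : c ^+ 2 + dot s s = 1).

Lemma rotation_head v : tnth (rotation v) ord0 = dot (cons_vec (c, s)) v.
Proof.
rewrite -[v in RHS]uncons_vecK; case: (uncons_vec v) (uncons_vecK v) => x u e.
rewrite /rotation -e cons_vecK tnth_cons0 dot_cons /= dot_translate dot_scale.
rewrite (_ : dot s s = 1 - c ^+ 2); last by rewrite -unit addrAC subrr add0r.
by field.
Qed.

Lemma rotation_norm v : dot (rotation v) (rotation v) = dot v v.
Proof.
case: (uncons_vec v) (uncons_vecK v) => x u <-.
rewrite /rotation cons_vecK !dot_cons /= !dot_translate !dot_scale.
rewrite ![dot (translate _ _) _]dotC !dot_translate !dot_scale.
rewrite (dotC u s) (_ : dot s s = 1 - c ^+ 2); last first.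
  by rewrite -unit addrAC subrr add0r.
by field.
Qed.

Lemma rotation_scale r v : rotation (scale r v) = scale r (rotation v).
Proof.
case: (uncons_vec v) (uncons_vecK v) => x u <-.
have -> : scale r (cons_vec (x, u)) = cons_vec (r * x, scale r u).
  apply: eq_from_tnth => i; have [j ->|->] := unliftP ord0 i.
    by rewrite tnth_scale !tnth_consS tnth_scale.
  by rewrite tnth_scale !tnth_cons0.
apply: eq_from_tnth => i; rewrite /rotation !cons_vecK tnth_scale.
have [j ->|->] := unliftP ord0 i.
  by rewrite !tnth_consS /= !tnth_translate !tnth_scale !dot_scale; ring.
by rewrite !tnth_cons0 /= !dot_translate !dot_scale; ring.
Qed.

End PlaneRotation.
End Rotation.

Section Sphere.
Context (R : realType) (d : nat).
Local Notation Rvec := (d.-tuple (measurableTypeR R)).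
Local Notation mu := (@lebesgue_vec R d).

Lemma enormE (v : Rvec) : enorm v = Num.sqrt (dot v v).
Proof. by congr Num.sqrt; apply: eq_bigr => i _; rewrite expr2. Qed.

Definition direction (v : Rvec) : Rvec := scale (enorm v)^-1 v.

Definition punctured_ball : set Rvec := [set v | 0 < enorm v <= 1].

Lemma enorm_scale r (v : Rvec) : 0 <= r -> enorm (scale r v) = r * enorm v.
Proof.
move=> r0; rewrite !enormE dot_scale dotC dot_scale mulrA -expr2.
by rewrite sqrtrM ?sqr_ge0 // sqrtr_sqr ger0_norm.
Qed.

Lemma enorm_ge0 (v : Rvec) : 0 <= enorm v.
Proof. exact: sqrtr_ge0. Qed.

Lemma scaleA r r' (v : Rvec) : scale r (scale r' v) = scale (r * r') v.
Proof. by apply: eq_from_tnth => i; rewrite !tnth_scale mulrA. Qed.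

Lemma scale1 (v : Rvec) : scale 1 v = v.
Proof. by apply: eq_from_tnth => i; rewrite !tnth_scale mul1r. Qed.

(** In these terms the cone measure is the image of Lebesgue measure on the punctured
unit ball under radial projection. *)
Lemma coneE (A : set Rvec) : cone A = direction @^-1` A `&` punctured_ball.
Proof.
apply/seteqP; split=> v.
  move=> [r [a [/andP[r0 r1] Sa Aa ->]]].
  rewrite -/(scale r a).
  have e : enorm (scale r a) = r by rewrite enorm_scale ?ltW // Sa mulr1.
  split; last by rewrite /punctured_ball /= e r0.
  rewrite /preimage /= /direction e.
  by rewrite scaleA mulVf ?gt_eqF // scale1.
move=> [/= Av /andP[v0 v1]]; exists (enorm v), (direction v); split=> //.
- by rewrite v0.
- by rewrite /sphere /= enorm_scale ?invr_ge0 ?enorm_ge0 // mulVf // gt_eqF.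
- by rewrite -/(scale _ _) scaleA divff ?gt_eqF // scale1.
Qed.

Lemma measurable_enorm : measurable_fun [set: Rvec] (@enorm R d).
Proof.
apply: (measurableT_comp (f := @Num.sqrt R)).
  by apply: continuous_measurable_fun => x; exact: sqrt_continuous.
apply: measurable_sum => i; apply: measurable_funX; exact: measurable_tnth.
Qed.

Lemma measurable_direction : measurable_fun [set: Rvec] direction.
Proof.
apply/measurable_fun_tnthP => i.
rewrite (_ : _ \o _ = fun v => (enorm v `^ (-1)) * tnth v i); last first.
  by apply/funext => v; rewrite /= tnth_scale powR_inv1 ?enorm_ge0.
apply: measurable_funM; last exact: measurable_tnth.
apply: (measurableT_comp (f := fun x : R => x `^ (-1))).
  exact: measurable_powR.
exact: measurable_enorm.
Qed.

Lemma measurable_punctured_ball : measurable punctured_ball.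
Proof.
rewrite (_ : punctured_ball = @enorm R d @^-1` `]0, 1]).
  by rewrite -[X in measurable X]setTI; apply: measurable_enorm.
by apply/seteqP; split=> v /=; rewrite in_itv.
Qed.

End Sphere.

(** * The surface measure of the sphere *)

Section Cube.
Context (R : realType) (J : set (measurableTypeR R)).
Hypothesis mJ : measurable J.
Local Notation Rvec d := (d.-tuple (measurableTypeR R)).

Definition cube d : set (Rvec d) := [set v | forall i, J (tnth v i)].

Lemma measurable_cube d : measurable (@cube d).
Proof.
rewrite (_ : @cube d = \bigcap_i ((fun v : Rvec d => tnth v i) @^-1` J)).
  apply: fin_bigcap_measurable => // i _.
  by rewrite -[X in measurable X]setTI; apply: measurable_tnth.
by apply/seteqP; split=> [v vJ i _|v vJ i]; exact: vJ.
Qed.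

Lemma cube_volumeS d : (@lebesgue_vec R d.+1 (@cube d.+1) =
  @lebesgue_measure R J * @lebesgue_vec R d (@cube d))%E.
Proof.
rewrite -product_measure1E //; last exact: measurable_cube.
rewrite /= /pushforward; congr (_ _).
apply/seteqP; split=> -[x v]; rewrite /preimage /cube /=.
  move=> xv; split; first by have := xv ord0; rewrite tnth_cons0.
  by move=> i; have := xv (lift ord0 i); rewrite tnth_consS.
move=> [Jx Jv] i; have [j ->|->] := unliftP ord0 i.
  by rewrite tnth_consS.
by rewrite tnth_cons0.
Qed.

Lemma cube_volume0 : @lebesgue_vec R 0 (@cube 0) = 1%E.
Proof. by rewrite /= diracE mem_set // => -[]. Qed.

Lemma cube_volume_fin d : (@lebesgue_measure R J < +oo)%E ->
  (@lebesgue_vec R d (@cube d) < +oo)%E.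
Proof.
move=> Joo; elim: d => [|d IH]; first by rewrite cube_volume0 ltry.
by rewrite cube_volumeS lte_mul_pinfty // ge0_fin_numE.
Qed.

Lemma cube_volume_gt0 d : (0 < @lebesgue_measure R J)%E ->
  (0 < @lebesgue_vec R d (@cube d))%E.
Proof.
move=> J0; elim: d => [|d IH]; first by rewrite cube_volume0.
by rewrite cube_volumeS mule_gt0.
Qed.

End Cube.

Section Surface.
Context (R : realType) (d : nat).
Local Notation Rvec := (d.+1.-tuple (measurableTypeR R)).
Local Notation mu := (@lebesgue_vec R d.+1).
Local Notation ball := (@punctured_ball R d.+1).
Local Notation sphere := (@sphere R d.+1).

Lemma sqr_tnth_le (v : Rvec) i : tnth v i ^+ 2 <= dot v v.
Proof.
rewrite /dot (bigD1 i) //= -expr2 lerDl.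
by apply: sumr_ge0 => j _; rewrite -expr2 sqr_ge0.
Qed.

Lemma dot_ge0 (v : Rvec) : 0 <= dot v v.
Proof. by apply: sumr_ge0 => j _; rewrite -expr2 sqr_ge0. Qed.

Lemma norm_tnth_le (v : Rvec) i : `|tnth v i| <= enorm v.
Proof. by rewrite enormE -sqrtr_sqr ler_wsqrtr // sqr_tnth_le. Qed.

Lemma ball_volume_fin : (mu ball < +oo)%E.
Proof.
have mI : measurable (`[(-1)%R, 1%R]%classic : set (measurableTypeR R)) by [].
apply: le_lt_trans (cube_volume_fin mI d.+1 _); last first.
  rewrite lebesgue_measure_itv /=; case: ifP => _; rewrite ?ltry //.
apply: le_measure; rewrite ?inE; first exact: measurable_punctured_ball.
  exact: measurable_cube.
move=> v /andP[_ v1] i; rewrite /= in_itv /= -ler_norml.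
exact: le_trans (norm_tnth_le v i) v1.
Qed.

Lemma ball_volume_gt0 : (0 < mu ball)%E.
Proof.
(* A cube of side 1 / n with a vertex at 0 lies in the unit ball of R^n, since the
   square of its diameter is 1 / n; the open lower faces exclude 0. *)
have mI : measurable (`]0%R, (d.+1%:R^-1 : R)]%classic : set (measurableTypeR R)) by [].
apply: lt_le_trans (cube_volume_gt0 mI d.+1 _) _.
  rewrite lebesgue_measure_itv /= lte_fin invr_gt0 ltr0Sn.
  by rewrite lte_fin subr0 invr_gt0 ltr0Sn.
apply: le_measure; rewrite ?inE; first exact: measurable_cube.
  exact: measurable_punctured_ball.
move=> v vI; rewrite /punctured_ball /=; apply/andP; split.
  apply: lt_le_trans (norm_tnth_le v ord0).
  by have := vI ord0; rewrite /= in_itv /= => /andP[v0 _]; rewrite normr_gt0 gt_eqF.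
rewrite enormE -[leRHS]sqrtr1 ler_wsqrtr //.
apply: (@le_trans _ _ (\sum_(i < d.+1) d.+1%:R^-1 ^+ 2)).
  apply: ler_sum => i _; rewrite -expr2.
  have := vI i; rewrite /= in_itv /= => /andP[v0 v1].
  by rewrite lerXn2r // nnegrE ?invr_ge0 ?ler0n // ltW.
rewrite sumr_const card_ord -[leLHS]mulr_natl expr2 mulrA divff ?pnatr_eq0 // mul1r.
by rewrite invf_le1 ?ltr0Sn // ler1n.
Qed.

Let mball : measurable ball := @measurable_punctured_ball R d.+1.
Let mdir : measurable_fun [set: Rvec] (@direction R d.+1) :=
  @measurable_direction R d.+1.

Let inv_volume : {nonneg R}.
Proof.
by apply: (@NngNum _ ((fine (mu ball))^-1)); rewrite invr_ge0 fine_ge0.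
Defined.

(** The function [sphere_measure], as a bundled measure: Lebesgue measure on the
punctured ball, pushed forward by radial projection and normalised. *)
Definition surface : {measure set Rvec -> \bar R} :=
  mscale inv_volume (measure_function_pushforward__canonical__measure_function_Measure
    (mrestr mu mball) mdir).

Lemma sphere_measureE : @sphere_measure R d.+1 = surface :> (set Rvec -> \bar R).
Proof.
apply/funext => A; rewrite /sphere_measure /surface /= /mscale /=.
rewrite /pushforward /mrestr -coneE coneE preimage_setT setTI.
by [].
Qed.

End Surface.

Section SurfaceIntegral.
Context (R : realType) (d : nat).
Local Notation Rvec := (d.+1.-tuple (measurableTypeR R)).
Local Notation mu := (@lebesgue_vec R d.+1).
Local Notation ball := (@punctured_ball R d.+1).
Local Notation sphere := (@sphere R d.+1).
Local Notation surface := (@surface R d).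

Lemma surfaceE A : surface A = ((fine (mu ball))^-1%:E * mu (cone A))%E.
Proof. by rewrite coneE. Qed.

Lemma sphereP (v : Rvec) : sphere v <-> dot v v = 1.
Proof.
rewrite /Defs.sphere /= enormE; split=> [v1|->]; last exact: sqrtr1.
by rewrite -[LHS]sqr_sqrtr ?dot_ge0 // v1 expr1n.
Qed.

Lemma measurable_sphere : measurable sphere.
Proof.
rewrite (_ : sphere = @enorm R d.+1 @^-1` [set 1]) //.
by rewrite -[X in measurable X]setTI; apply: measurable_enorm.
Qed.

Lemma surface_sphere : surface sphere = 1%E.
Proof.
rewrite surfaceE coneE (_ : _ `&` _ = ball); last first.
  apply/seteqP; split=> [v []//|v vB]; split=> //.
  have /andP[v0 _] := vB.
  rewrite /preimage /Defs.sphere /= enorm_scale ?invr_ge0 ?enorm_ge0 //.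
  by rewrite mulVf // gt_eqF.
have fB : mu ball \is a fin_num by rewrite ge0_fin_numE // ball_volume_fin.
rewrite -[X in (_ * X)%E](fineK fB) -EFinM mulVf //.
by rewrite gt_eqF // fine_gt0 // ball_volume_gt0 ball_volume_fin.
Qed.

Section Rotate.
Context (c : R) (s : d.-tuple (measurableTypeR R)).
Hypotheses (c1 : 1 + c != 0) (cs1 : c ^+ 2 + dot s s = 1).
Local Notation T := (rotation c s).

Lemma enorm_rotation v : enorm (T v) = enorm v.
Proof. by rewrite !enormE rotation_norm. Qed.

(** A linear isometry commutes with radial projection. *)
Lemma surface_rotation A : measurable A -> surface (T @^-1` A) = surface A.
Proof.
move=> mA; rewrite !surfaceE -((rotation_preserves c s).2 (cone A)); last first.
  rewrite coneE; apply: measurableI; last exact: measurable_punctured_ball.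
  by rewrite -[X in measurable X]setTI; exact: measurable_direction.
congr (_ * mu _)%E; rewrite !coneE; apply/seteqP.
by split=> v; rewrite /preimage /punctured_ball /direction /= enorm_rotation
  -rotation_scale.
Qed.
End Rotate.

(** The restriction of such a function to the sphere is integrable, and polynomial
functions are of this kind. *)
Definition admissible (f : Rvec -> R) := measurable_fun [set: Rvec] f /\
  exists M, forall v, sphere v -> `|f v| <= M.

Lemma admissible_cst a : admissible (fun=> a).
Proof. by split; [exact: measurable_cst|exists `|a|]. Qed.

Lemma admissible_tnth i : admissible (fun v => tnth v i).
Proof.
split; first exact: measurable_tnth.
by exists 1 => v <-; exact: norm_tnth_le.
Qed.

Lemma admissibleD f g : admissible f -> admissible g ->
  admissible (fun v => f v + g v).
Proof.
move=> [mf [M fM]] [mg [N gN]]; split; first exact: measurable_funD.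
exists (M + N) => v Sv; apply: le_trans (ler_normD _ _) _.
by apply: lerD; [exact: fM|exact: gN].
Qed.

Lemma admissibleM f g : admissible f -> admissible g ->
  admissible (fun v => f v * g v).
Proof.
move=> [mf [M fM]] [mg [N gN]]; split; first exact: measurable_funM.
exists (M * N) => v Sv; rewrite normrM.
by apply: ler_pM => //; [exact: fM|exact: gN].
Qed.

Lemma admissible_sum (I : Type) (r : seq I) (f : I -> Rvec -> R) :
  (forall i, admissible (f i)) -> admissible (fun v => \sum_(i <- r) f i v).
Proof.
move=> af; elim: r => [|i r IH].
  by under eq_fun do rewrite big_nil; exact: admissible_cst.
by under eq_fun do rewrite big_cons; exact: admissibleD.
Qed.

Lemma admissible_prod (I : Type) (r : seq I) (f : I -> Rvec -> R) :
  (forall i, admissible (f i)) -> admissible (fun v => \prod_(i <- r) f i v).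
Proof.
move=> af; elim: r => [|i r IH].
  by under eq_fun do rewrite big_nil; exact: admissible_cst.
by under eq_fun do rewrite big_cons; exact: admissibleM.
Qed.

Lemma admissibleX f n : admissible f -> admissible (fun v => f v ^+ n).
Proof.
move=> af; elim: n => [|n IH]; first exact: admissible_cst.
by under eq_fun do rewrite exprS; exact: admissibleM.
Qed.

Lemma admissible_dot (u : Rvec) : admissible (dot u).
Proof.
apply: admissible_sum => i; apply: admissibleM; first exact: admissible_cst.
exact: admissible_tnth.
Qed.

Lemma admissible_integrable f : admissible f ->
  surface.-integrable sphere (EFin \o f).
Proof.
move=> [mf [M fM]]; apply: measurable_bounded_integrable.
- exact: measurable_sphere.
- by rewrite surface_sphere ltry.
- exact: measurable_funTS.
- exists M; split; first exact: num_real.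
  by move=> N MN v Sv; exact: le_trans (fM _ Sv) (ltW MN).
Qed.

Definition mean (f : Rvec -> R) : R := \int[surface]_(v in sphere) f v.

Lemma meanD f g : admissible f -> admissible g ->
  mean (fun v => f v + g v) = mean f + mean g.
Proof.
by move=> af ag; apply: RintegralD; [exact: measurable_sphere|
  exact: admissible_integrable|exact: admissible_integrable].
Qed.

Lemma meanZ a f : admissible f -> mean (fun v => a * f v) = a * mean f.
Proof.
by move=> af; apply: RintegralZl; [exact: measurable_sphere|
  exact: admissible_integrable].
Qed.

Lemma mean_cst a : mean (fun=> a) = a.
Proof.
rewrite /mean Rintegral_cst ?surface_sphere ?mulr1 //; exact: measurable_sphere.
Qed.

Lemma mean_sum (I : Type) (r : seq I) (f : I -> Rvec -> R) :
  (forall i, admissible (f i)) ->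
  mean (fun v => \sum_(i <- r) f i v) = \sum_(i <- r) mean (f i).
Proof.
move=> af; elim: r => [|i r IH].
  by under eq_fun do rewrite big_nil; rewrite big_nil mean_cst.
under eq_fun do rewrite big_cons; rewrite big_cons meanD ?IH //.
exact: admissible_sum.
Qed.

Lemma eq_mean f g : (forall v, dot v v = 1 -> f v = g v) -> mean f = mean g.
Proof.
move=> fg; apply: eq_Rintegral => v; rewrite inE => Sv.
by apply: fg; exact/sphereP.
Qed.

Lemma mean_integral f : admissible f ->
  (\int[@sphere_measure R d.+1]_(v in sphere) (f v)%:E)%E = (mean f)%:E.
Proof.
move=> af; rewrite sphere_measureE /mean /Rintegral fineK //.
apply: integrable_fin_num; [exact: measurable_sphere|exact: admissible_integrable].
Qed.

Lemma mean_rotation c (s : d.-tuple (measurableTypeR R)) f :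
  1 + c != 0 -> c ^+ 2 + dot s s = 1 -> admissible f ->
  admissible (f \o rotation c s) -> mean (f \o rotation c s) = mean f.
Proof.
move=> c1 cs1 af afT; have mT := (rotation_preserves c s).1.
rewrite /mean /Rintegral; congr fine.
have TS : rotation c s @^-1` sphere = sphere.
  by apply/seteqP; split=> v; rewrite /preimage /Defs.sphere /= enorm_rotation.
rewrite -[X in (\int[_]_(v in X) _)%E = _]TS.
have := @integral_pushforward _ _ _ _ _ _ mT surface sphere (EFin \o f).
rewrite TS => <-; first last.
- exact: measurable_sphere.
- exact: admissible_integrable.
- by apply/measurable_EFinP; exact: af.1.
apply: eq_measure_integral => A mA _.
exact: surface_rotation.
Qed.

End SurfaceIntegral.

(** * Moments of the sphere *)

Lemma eq_poly_horner (F : numFieldType) (p q : {poly F}) :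
  (forall x, p.[x] = q.[x]) -> p = q.
Proof.
move=> pq; apply/eqP; rewrite -subr_eq0; apply: contraT => pq0.
have := max_poly_roots (rs := [seq i%:R | i <- iota 0 (size (p - q))]) pq0.
rewrite size_map size_iota ltnn; apply.
  by apply/allP => _ /mapP[i _ ->]; rewrite rootE hornerD hornerN pq subrr.
by rewrite map_inj_uniq ?iota_uniq // => i j /eqP; rewrite eqr_nat => /eqP.
Qed.

Section Moments.
Context (R : realType) (d : nat).
Local Notation n := d.+2.
Local Notation Rvec := (n.-tuple (measurableTypeR R)).
Local Notation mean := (@mean R d.+1).

Definition moment k : R := mean (fun v => tnth v ord0 ^+ k).

(** A rotation carries the coordinate [tnth v ord0] to [dot z v], unless [z] is the
opposite of the first basis vector, where the formula for the rotation breaks down. *)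
Lemma mean_dot_generic (z : Rvec) k : 1 + tnth z ord0 != 0 -> dot z z = 1 ->
  mean (fun v => dot z v ^+ k) = moment k.
Proof.
case: (uncons_vec z) (uncons_vecK z) => c s <-; rewrite tnth_cons0 dot_cons -expr2.
move=> c1 cs1; rewrite /moment.
rewrite -[RHS](mean_rotation c1 cs1 (f := fun v => tnth v ord0 ^+ k)).
- by apply: eq_mean => v _ /=; rewrite rotation_head.
- by apply: admissibleX; exact: admissible_tnth.
- under [X in admissible X]eq_fun do rewrite /= rotation_head //.
  by apply: admissibleX; exact: admissible_dot.
Qed.

Definition basis (i : 'I_n) : Rvec := [tuple (i == j)%:R | j < n].

Lemma dot_basis i (v : Rvec) : dot (basis i) v = tnth v i.
Proof.
rewrite /dot (bigD1 i) //= tnth_mktuple eqxx mul1r big1 ?addr0 // => j ji.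
by rewrite tnth_mktuple eq_sym (negPf ji) mul0r.
Qed.

Lemma tnth_basis i j : tnth (basis i) j = (i == j)%:R.
Proof. by rewrite tnth_mktuple. Qed.

(** The second basis vector and its opposite both give the moment of the first one. *)
Lemma moment_odd k : odd k -> moment k = 0.
Proof.
move=> ok; pose j : 'I_n := lift ord0 ord0.
have e1 : mean (fun v => dot (basis j) v ^+ k) = moment k.
  apply: mean_dot_generic; last by rewrite dot_basis tnth_basis eqxx.
  by rewrite tnth_basis addr0 oner_eq0.
have e2 : mean (fun v => dot (scale (-1) (basis j)) v ^+ k) = moment k.
  apply: mean_dot_generic.
    by rewrite tnth_scale tnth_basis mulr0 addr0 oner_eq0.
  by rewrite dot_scale dotC dot_scale dot_basis tnth_basis eqxx mulr1 mulrNN mulr1.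
have e3 : mean (fun v => dot (scale (-1) (basis j)) v ^+ k) = - moment k.
  rewrite -e1 -[RHS]mulN1r -meanZ; last by apply: admissibleX; exact: admissible_dot.
  apply: eq_mean => v _; rewrite dotC dot_scale dotC exprMn; congr (_ * _).
  by rewrite -signr_odd ok.
by move: e3; rewrite e2; lra.
Qed.

Lemma mean_dot (z : Rvec) k : dot z z = 1 ->
  mean (fun v => dot z v ^+ k) = moment k.
Proof.
have [c1|c1] := eqVneq (1 + tnth z ord0) 0; last exact: mean_dot_generic.
case: (uncons_vec z) (uncons_vecK z) c1 => c s <-; rewrite tnth_cons0 => c1.
have -> : c = -1 by apply/eqP; rewrite -addr_eq0 addrC c1.
rewrite dot_cons mulrNN mulr1 => /eqP; rewrite -subr_eq0 addrAC subrr add0r => /eqP s0.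
have s0i i : tnth s i = 0.
  by apply/eqP; rewrite -sqrf_eq0 eq_le sqr_ge0 andbT -s0 sqr_tnth_le.
have -> : moment k = (-1) ^+ k * moment k.
  have [ok|ek] := boolP (odd k); first by rewrite moment_odd // mulr0.
  by rewrite -signr_odd (negPf ek) mul1r.
rewrite -meanZ; last by apply: admissibleX; exact: admissible_tnth.
apply: eq_mean => v _; rewrite -exprMn mulN1r; congr (_ ^+ _).
rewrite -{1}[v]uncons_vecK dot_cons mulN1r -[RHS]addr0; congr (_ + _).
by rewrite /dot big1 // => i _; rewrite s0i mul0r.
Qed.

Let am k (j : 'I_n) l : admissible (fun v : Rvec => tnth v ord0 ^+ k * tnth v j ^+ l).
Proof. by apply: admissibleM; apply: admissibleX; exact: admissible_tnth. Qed.

(** For every real s the mean of (v_0 + s v_j)^(2m+2) is the moment of that order times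
(1 + s^2)^(m+1), the vector with coordinates 1 and s having squared norm 1 + s^2.
The lemma compares the coefficients of s^2. *)
Lemma mean_mixed m (j : 'I_n) : j != ord0 ->
  (2 * m + 1)%:R * mean (fun v => tnth v ord0 ^+ (2 * m) * tnth v j ^+ 2) =
  moment (2 * m.+1).
Proof.
move=> j0.
pose p : {poly R} := \poly_(i < (2 * m.+1).+1)
  (mean (fun v => tnth v ord0 ^+ (2 * m.+1 - i) * tnth v j ^+ i) *+ 'C(2 * m.+1, i)).
pose q : {poly R} := moment (2 * m.+1) *: (1 + 'X^2) ^+ m.+1.
have /(congr1 (fun r : {poly R} => r`_2)) : p = q.
  apply: eq_poly_horner => s.
  have s1 : 0 < 1 + s ^+ 2 by rewrite ltr_pwDl // sqr_ge0.
  pose r := Num.sqrt (1 + s ^+ 2).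
  have r2 : r ^+ 2 = 1 + s ^+ 2 by rewrite sqr_sqrtr // ltW.
  have r0 : r != 0 by rewrite gt_eqF // sqrtr_gt0.
  (* the unit vector in the direction of e_0 + s e_j *)
  pose z := scale r^-1 (translate (scale s (basis j)) (basis ord0)).
  have zE v : dot z v = r^-1 * (tnth v ord0 + s * tnth v j).
    rewrite dotC dot_scale dot_translate dot_scale.
    by rewrite [dot v _]dotC [dot v (basis j)]dotC !dot_basis.
  have z1 : dot z z = 1.
    rewrite zE !tnth_scale !tnth_translate !tnth_scale !tnth_basis !eqxx (negPf j0).
    rewrite [ord0 == j]eq_sym (negPf j0) mulr0 mulr1 addr0 add0r.
    rewrite mulrCA -mulrDr mulrA -invfM -[r * r]expr2 r2.
    by rewrite -[X in _ * X](_ : 1 + s ^+ 2 = _) ?mulVf ?gt_eqF //; ring.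
  rewrite horner_poly hornerZ horner_exp hornerD hornerXn hornerC -r2.
  rewrite -(mean_dot (2 * m.+1) z1) mulrC -exprM.
  rewrite -meanZ; last by apply: admissibleX; exact: admissible_dot.
  transitivity (mean (fun v => (tnth v ord0 + s * tnth v j) ^+ (2 * m.+1))).
    under [RHS]eq_mean => v _ do rewrite exprDn.
    rewrite mean_sum; last first.
      by move=> i; under eq_fun do rewrite exprMn mulrCA -mulrnAr mulrC -mulr_natr;
         apply: admissibleM; do ?exact: admissible_cst; apply: admissibleM;
         [exact: am|exact: admissible_cst].
    apply: eq_bigr => i _; rewrite mulrnAl -mulr_natr mulrAC.
    rewrite -mulrA [LHS]mulrC -meanZ //; apply: eq_mean => v _.
    by rewrite exprMn -[RHS]mulr_natr; ring.
  by apply: eq_mean => v _; rewrite zE exprMn exprVn mulrA divff ?mul1r // expf_neq0.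
rewrite coef_poly coefZ exprDn coef_sum ltnS mulnS ltn_addr //.
(* On the right the coefficient of s^2 comes from the term of index 1 alone. *)
rewrite (bigD1 (inord 1)) //= inordK // big1 => [|i]; last first.
  move=> i1; rewrite expr1n mul1r -exprM coefMn coefXn.
  by case: eqP => [i2|]; rewrite ?mul0rn //; case/negP: i1; apply/eqP/ord_inj;
     rewrite inordK //; lia.
rewrite expr1n mul1r -exprM coefMn coefXn eqxx bin1 addr0.
have -> : 'C(2 + 2 * m, 2) = (m.+1 * (2 * m + 1))%N.
  by rewrite bin2 (_ : _ * _ = (m.+1 * (2 * m + 1)).*2)%N ?doubleK //=; lia.
rewrite addKn -[mean _ *+ _]mulr_natr natrM -[true%:R *+ _]/(m.+1%:R) => e.
have m0 : (m.+1%:R : R) != 0 by rewrite pnatr_eq0.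
by apply: (mulIf m0); rewrite -e; ring.
Qed.

(** Insert 1 = sum of v_j^2 into the mean of v_0^(2m). *)
Lemma momentS m :
  (n + 2 * m)%:R * moment (2 * m.+1) = (2 * m + 1)%:R * moment (2 * m).
Proof.
have -> : moment (2 * m) =
    \sum_j mean (fun v => tnth v ord0 ^+ (2 * m) * tnth v j ^+ 2).
  rewrite -mean_sum; last by move=> j; exact: am.
  apply: eq_mean => v v1; rewrite -mulr_sumr -[LHS]mulr1; congr (_ * _).
  by rewrite -v1; apply: eq_bigr => j _; rewrite expr2.
rewrite mulr_sumr big_ord_recl (eq_bigr (fun=> moment (2 * m.+1))); last first.
  by move=> j _; rewrite mean_mixed.
rewrite sumr_const card_ord (_ : mean _ = moment (2 * m.+1)); last first.
  by apply: eq_mean => v _; rewrite -exprD mulnS addnC.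
by rewrite -[moment _ *+ _]mulr_natl -mulrDl -natrD; congr (_%:R * _); lia.
Qed.

Lemma moment_even t : moment (2 * t) = c_real R n t.
Proof.
elim: t => [|t IH].
  rewrite /c_real !big_ord0 divr1 /moment -[RHS](mean_cst d.+1).
  by apply: eq_mean => v _; rewrite expr0.
have n0 : ((n + 2 * t)%:R : R) != 0 by rewrite pnatr_eq0.
apply: (mulfI n0); rewrite momentS IH /c_real !big_ord_recr /=.
rewrite invfM; move: ((n + 2 * t)%:R : R) n0 => N n0.
move: (\prod_(i < t) (2 * i + 1)%:R) (\prod_(i < t) _)^-1 => a b.
by field.
Qed.

(** A monomial given by a word in the coordinates: in this form powers of [dot u v]
expand without multinomial coefficients. *)
Definition word k (f : {ffun 'I_k -> 'I_n}) (v : Rvec) : R :=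
  \prod_j tnth v (f j).

Lemma dotX k (u v : Rvec) : dot u v ^+ k = \sum_f @word k f u * word f v.
Proof.
rewrite -[k in LHS]card_ord -prodr_const (bigA_distr_bigA (fun _ i => _)).
by apply: eq_bigr => f _; rewrite -big_split.
Qed.

Lemma admissible_word k (f : {ffun 'I_k -> 'I_n}) : admissible (word f).
Proof. by apply: admissible_prod => j; exact: admissible_tnth. Qed.

Lemma sum_mean_word k u : dot u u = 1 ->
  \sum_f @word k f u * mean (word f) = moment k.
Proof.
move=> u1; rewrite -(mean_dot k u1).
under [in RHS]eq_mean => v _ do rewrite dotX.
rewrite mean_sum; last first.
  by move=> f; apply: admissibleM; [exact: admissible_cst|exact: admissible_word].
by apply: eq_bigr => f _; rewrite meanZ //; exact: admissible_word.
Qed.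

(** Both sides are the mean of [dot u v ^+ k] over [u] and [v]. *)
Lemma sum_sqr_mean_word k : \sum_f mean (@word k f) ^+ 2 = moment k.
Proof.
rewrite -[RHS](mean_cst d.+1) -(eq_mean (@sum_mean_word k)) mean_sum; last first.
  by move=> f; apply: admissibleM; [exact: admissible_word|exact: admissible_cst].
apply: eq_bigr => f _; rewrite expr2 -meanZ; last exact: admissible_word.
by apply: eq_mean => v _; rewrite mulrC.
Qed.

Lemma mean_word_odd k (f : {ffun 'I_k -> 'I_n}) : odd k -> mean (word f) = 0.
Proof.
move=> ok; apply/eqP; rewrite -sqrf_eq0; apply/eqP.
have /psumr_eq0P : \sum_f mean (@word k f) ^+ 2 = 0.
  by rewrite sum_sqr_mean_word moment_odd.
by apply=> // g _; exact: sqr_ge0.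
Qed.

End Moments.

Section Designs.
Context (R : realType) (d : nat).
Local Notation n := d.+2.
Local Notation Rvec := (n.-tuple (measurableTypeR R)).
Local Notation mean := (@mean R d.+1).

Definition tuple_of_col (x : 'cV[R]_n) : Rvec := [tuple x i 0 | i < n].

Lemma tnth_col x i : tnth (tuple_of_col x) i = x i 0.
Proof. by rewrite tnth_mktuple. Qed.

Lemma dot_col x y : dot (tuple_of_col x) (tuple_of_col y) = inner idfun x y.
Proof. by apply: eq_bigr => i _; rewrite !tnth_col. Qed.

Section Design.
Context (X : {fset 'cV[R]_n}) (w : 'cV[R]_n -> R).

Definition cubature (f : Rvec -> R) : R :=
  \sum_(x <- X) w x * f (tuple_of_col x).

(** The squared differences, summed over all words, give the double sum over the design,
minus twice the moment, plus the moment, and the design equation says that this is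
zero. *)
Lemma tt_design_word t (f : {ffun 'I_(2 * t) -> 'I_n}) :
  real_tt_design t X w -> cubature (word f) = mean (word f).
Proof.
move=> [[X1 w0 wsum] Xt]; apply/eqP; rewrite -subr_eq0 -sqrf_eq0; apply/eqP.
have /psumr_eq0P : \sum_f (cubature (@word R d (2 * t) f) - mean (word f)) ^+ 2 = 0.
  under eq_bigr do rewrite sqrrB.
  rewrite big_split /= sumrB sum_sqr_mean_word.
  have -> : \sum_f cubature (@word R d (2 * t) f) ^+ 2 = moment R d (2 * t).
    rewrite moment_even -Xt.
    under eq_bigr do rewrite expr2 mulr_suml.
    rewrite exchange_big; apply: eq_bigr => x _.
    under eq_bigr do rewrite mulr_sumr.
    rewrite exchange_big; apply: eq_bigr => y _.
    rewrite exprM -normrX ger0_norm ?sqr_ge0 // -exprM -dot_col dotX mulr_sumr.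
    by apply: eq_bigr => g _; ring.
  have -> : \sum_f cubature (@word R d (2 * t) f) * mean (word f) *+ 2 =
      moment R d (2 * t) *+ 2.
    rewrite sumrMnl; congr (_ *+ _).
    under eq_bigr do rewrite mulr_suml.
    rewrite exchange_big -[RHS]mul1r -wsum mulr_suml !big_seq; apply: eq_bigr => x xX.
    rewrite -(@sum_mean_word R d (2 * t) (tuple_of_col x)) ?dot_col ?X1 // mulr_sumr.
    by apply: eq_bigr => g _; rewrite mulrA.
  by ring.
by apply=> // g _; exact: sqr_ge0.
Qed.

Definition monom (s : seq 'I_n) (v : Rvec) : R := \prod_(i <- s) tnth v i.

Lemma monom_word (s : seq 'I_n) k : size s = k ->
  exists f : {ffun 'I_k -> 'I_n}, monom s = word f.
Proof.
move=> sk; exists [ffun j => nth ord0 s (val j)]; apply/funext => v.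
rewrite /monom (big_nth ord0) sk big_mkord.
by apply: eq_bigr => j _; rewrite ffunE.
Qed.

Lemma admissible_monom s : admissible (monom s).
Proof. by apply: admissible_prod => j; exact: admissible_tnth. Qed.

Lemma monom_lift s v : dot v v = 1 ->
  monom s v = \sum_i monom [:: i, i & s] v.
Proof.
move=> v1; rewrite -[LHS]mul1r -v1 mulr_suml; apply: eq_bigr => i _.
by rewrite /monom !big_cons mulrA.
Qed.

(** A monomial of even degree below [2 * t] is on the sphere a sum of monomials of
degree two more. *)
Lemma tt_design_monom t s : real_tt_design t X w ->
  (size s <= 2 * t)%N -> ~~ odd (size s) -> cubature (monom s) = mean (monom s).
Proof.
move=> Xt; have [[X1 _ _] _] := Xt.
have [k] := ubnP (2 * t - size s); elim: k s => // k IH s sk st es.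
have [e|e] := eqVneq (size s) (2 * t)%N.
  by have [f ->] := monom_word e; exact: tt_design_word.
have -> : mean (monom s) = \sum_i mean (monom [:: i, i & s]).
  rewrite -mean_sum; last by move=> i; exact: admissible_monom.
  by apply: eq_mean => v; exact: monom_lift.
have -> : cubature (monom s) = \sum_i cubature (monom [:: i, i & s]).
  rewrite /cubature exchange_big !big_seq; apply: eq_bigr => x xX.
  by rewrite monom_lift ?mulr_sumr // dot_col X1.
have lt : ((size s).+2 <= 2 * t)%N.
  by move: es st e sk; lia.
by apply: eq_bigr => i _; apply: IH; rewrite /= ?negbK //; lia.
Qed.

Lemma monomN s x : monom s (tuple_of_col (- x)) =
  (-1) ^+ size s * monom s (tuple_of_col x).
Proof.
elim: s => [|i s IH]; rewrite /monom; first by rewrite !big_nil mulr1.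
by rewrite !big_cons -!/(monom _ _) IH !tnth_col mxE exprS; ring.
Qed.

Lemma unit_neqN (x : 'cV[R]_n) : inner idfun x x = 1 -> - x != x.
Proof.
move=> x1; apply/eqP => e.
have x0 : x = 0.
  apply/matrixP => i j; rewrite mxE.
  by move/matrixP/(_ i j): e; rewrite !mxE; lra.
move: x1; rewrite x0 /inner big1 => [/eqP|i _]; rewrite ?mxE ?mul0r //.
by rewrite eq_sym oner_eq0.
Qed.

Hypotheses (X1 : {in X, forall x, inner idfun x x = 1})
  (Xline : {in X &, injective (@line R n)}).

Lemma antipodal_notin x : x \in X -> - x \notin X.
Proof.
move=> xX; apply/negP => NxX; have := unit_neqN (X1 xX).
rewrite (Xline NxX xX) ?eqxx //.
by rewrite -scaleN1r line_scale // oppr_eq0 oner_eq0.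
Qed.

Lemma antipodal_exists : exists (Y : {fset 'cV[R]_n}) v, antipodal_double X w Y v.
Proof.
exists (X `|` [fset - x | x in X])%fset.
exists (fun y => if y \in X then w y / 2 else w (- y) / 2); split=> // x xX.
by rewrite xX (negPf (antipodal_notin xX)) opprK.
Qed.

Context (Y : {fset 'cV[R]_n}) (v : 'cV[R]_n -> R).
Hypothesis XY : antipodal_double X w Y v.

Lemma antipodal_perm :
  perm_eq (enum_fset Y) (enum_fset X ++ [seq - x | x <- enum_fset X]).
Proof.
have [-> _] := XY; apply: uniq_perm => [||y].
- exact: fset_uniq.
- rewrite cat_uniq fset_uniq map_inj_uniq ?fset_uniq ?andbT; last exact: oppr_inj.
  apply/hasPn => _ /mapP[x xX ->]; exact: antipodal_notin.
- rewrite inE mem_cat; congr (_ || _).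
  by apply/imfsetP/mapP => -[x xX ->]; exists x.
Qed.

Lemma antipodal_sum (h : 'cV[R]_n -> R) :
  \sum_(y <- Y) h y = \sum_(x <- X) (h x + h (- x)).
Proof.
by rewrite (perm_big _ antipodal_perm) big_cat big_map big_split.
Qed.

Lemma card_antipodal : #|` Y | = (#|` X | + #|` X |)%N.
Proof.
by rewrite /= (perm_size antipodal_perm) size_cat size_map.
Qed.

(** Monomials of odd degree cancel in the antipodal double and have mean zero; those of
even degree at most [2 * t] are covered by [tt_design_monom]. *)
Lemma antipodal_spherical t : real_tt_design t X w ->
  spherical_design (2 * t).+1 Y v.
Proof.
move=> Xt; have [[_ w0 wsum] _] := Xt; have [YE vE] := XY; split.
  split.
  - move=> y; rewrite YE inE => /orP[/X1//|/imfsetP[x /= xX ->]].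
    rewrite -(X1 xX); apply: eq_bigr => i _; rewrite !mxE /=; ring.
  - move=> y; rewrite YE inE => /orP[yX|/imfsetP[x /= xX ->]].
      by rewrite (vE _ yX).1 divr_gt0 ?w0.
    by rewrite (vE _ xX).2 divr_gt0 ?w0.
  - rewrite antipodal_sum -wsum !big_seq; apply: eq_bigr => x xX.
    by rewrite (vE _ xX).1 (vE _ xX).2; field.
move=> p psize.
pose s (m : multinom n) : seq 'I_n := flatten [seq nseq (m i) i | i <- enum 'I_n].
have sE (m : multinom n) u : \prod_(i < n) (tnth u i) ^+ (m i) = monom (s m) u.
  rewrite /monom big_flatten big_map big_enum; apply: eq_bigr => i _.
  by rewrite big_nseq iter_mulr_1.
have size_s (m : multinom n) : size (s m) = mdeg m.
  rewrite mdegE size_flatten /shape -map_comp sumnE big_map big_enum.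
  by apply: eq_bigr => i _; rewrite /= size_nseq.
have pE (u : Rvec) : meval (tnth u) p = \sum_(m <- msupp p) mcoeff m p * monom (s m) u.
  by rewrite mevalE; apply: eq_bigr => m _; rewrite sE.
have admp : admissible (fun u => meval (tnth u) p).
  under eq_fun do rewrite pE.
  apply: admissible_sum => m.
  by apply: admissibleM; [exact: admissible_cst|exact: admissible_monom].
rewrite mean_integral //; congr (_%:E).
under eq_mean => u _ do rewrite pE.
rewrite mean_sum; last first.
  by move=> m; apply: admissibleM; [exact: admissible_cst|exact: admissible_monom].
under [RHS]eq_bigr => x _.
  rewrite (_ : meval _ p = meval (tnth (tuple_of_col x)) p); last first.
    by apply: meval_eq => i; rewrite tnth_col.
  rewrite pE mulr_sumr; over.
rewrite exchange_big !big_seq; apply: eq_bigr => m mp.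
rewrite meanZ; last exact: admissible_monom.
have sm : (size (s m) <= (2 * t).+1)%N.
  by rewrite size_s -ltnS; apply: leq_trans psize; exact: msize_mdeg_lt.
rewrite antipodal_sum.
have [om|em] := boolP (odd (size (s m))).
  have -> : mean (monom (s m)) = 0.
    by have [f ->] := monom_word (erefl (size (s m))); exact: mean_word_odd.
  rewrite mulr0 big_seq big1 // => x xX.
  rewrite (vE _ xX).1 (vE _ xX).2 monomN -signr_odd om; ring.
rewrite -(tt_design_monom Xt) //; last by move: sm em; lia.
rewrite /cubature mulr_sumr !big_seq; apply: eq_bigr => x xX.
by rewrite (vE _ xX).1 (vE _ xX).2 monomN -signr_odd (negPf em); field.
Qed.

End Design.
End Designs.

(** * The theorem *)

Theorem mainTheorem2 (R : realType) :
  [/\ exists (G : set 'M[R[i]]_2) (X : {fset 'cV[R[i]]_2}) (w : 'cV[R[i]]_2 -> R[i]),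
        [/\ finite_complex_reflection_group G,
            weighted_union_of_two_orbits G X w,
            complex_tt_design 9 X w & num_lines X = 32%N],
      exists (G : set 'M[R[i]]_3) (X : {fset 'cV[R[i]]_3}) (w : 'cV[R[i]]_3 -> R[i]),
        [/\ finite_complex_reflection_group G,
            weighted_union_of_two_orbits G X w,
            complex_tt_design 4 X w & num_lines X = 48%N],
      exists (G : set 'M[R[i]]_4) (X : {fset 'cV[R[i]]_4}) (w : 'cV[R[i]]_4 -> R[i]),
        [/\ finite_complex_reflection_group G,
            weighted_union_of_two_orbits G X w,
            complex_tt_design 5 X w & num_lines X = 400%N] &
      exists (G : set 'M[R]_4) (X : {fset 'cV[R]_4}) (w : 'cV[R]_4 -> R),
        [/\ finite_real_reflection_group G,
            weighted_union_of_two_orbits G X w,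
            real_tt_design 9 X w, num_lines X = 360%N &
            exists (Y : {fset 'cV[R]_4}) (v : 'cV[R]_4 -> R),
              [/\ antipodal_double X w Y v,
                  #|` Y | = 720%N & spherical_design 19 Y v]]].
Proof.
split; [exact: design_C2|exact: design_C3|exact: design_C4|].
have [G [X [w [GX wX Xt Xn]]]] := design_R4 R.
have [[X1 _ _] _] := Xt; have [x [y [_ _ Xline _ _]]] := wX.
have [Y [v XY]] := antipodal_exists w X1 Xline.
exists G, X, w; split=> //; exists Y, v; split=> //.
  rewrite (card_antipodal X1 Xline XY); move: Xn.
  by rewrite /num_lines card_in_imfset //= => ->.
exact: (antipodal_spherical X1 Xline XY Xt).
Qed.
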